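(* Let $X/\mathbf{Q}$ be a curve with a triple $(\mathcal{Q},W^0,W^{\infty})$ having good reduction at a prime $p$ (all as in the context). Let $e$ and $N$ be positive integers and let $P,Q \in X(\mathbf{Q}_p(p^{1/e}))$ be two points in the same residue disk, accurate to precision $N$. Let $P'$ be the very bad point of this residue disk if the disk is bad, and $P'=P$ otherwise; let $t$ be a local coordinate at $P'$ (in the integral sense defined in the context). Suppose that $\omega = g(t)\,dt$ is a differential of the second kind with $$g(t) = a_{-k} t^{-k} + a_{-k+1} t^{-k+1} + \cdots \in \mathbf{Z}_p[[t]][t^{-1}]$$ for some positive integer $k$. If $g$ is accurate to $p$-adic precision $N$ and truncated modulo $t^l$, then the tiny integral $\int_P^Q \omega$, computed by integrating the truncated Laurent series termwise and evaluating at $t(Q)$ and $t(P)$, is correct to precision $\min\{\nu_1,\nu_2,\nu_3\}$, where \begin{align*} \nu_1 &= 1/e + \min_{i \geq l} \{ i/e-\lfloor \log_p(i+1) \rfloor \}, \\ \nu_2 &= N + \min_{0 \leq i \leq l-1} \{ i/e- \lfloor \log_p(i+1) \rfloor \}, \\ \nu_3 &= N - k\max \{ \mathrm{ord}_{p}(t(P)),\mathrm{ord}_p(t(Q))\}-\lfloor \log_p(k-1) \rfloor, \end{align*} with the convention $\nu_3=+\infty$ if $k=1$.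
   Context: Curve. $X$ is a nonsingular projective geometrically irreducible curve of genus $g$ over $\mathbf{Q}$ given by a (possibly singular) plane model $\mathcal{Q}(x,y)=0$, with $\mathcal{Q} \in \mathbf{Z}[x,y]$ irreducible and monic in $y$; $d_x$ is the degree of $\mathcal{Q}$ in $y$ (the degree of $x: X\to\mathbf{P}^1$). $\Delta(x)\in\mathbf{Z}[x]$ is the discriminant of $\mathcal{Q}$ with respect to $y$ and $r=\Delta/\gcd(\Delta,d\Delta/dx)$. $W^0\in \mathrm{GL}_{d_x}(\mathbf{Q}[x,1/r])$ and $W^\infty\in \mathrm{GL}_{d_x}(\mathbf{Q}[x,1/x,1/r])$ are matrices such that, with $b^0_j=\sum_{i=0}^{d_x-1}W^0_{i+1,j+1}y^i$ and $b^\infty_j=\sum_{i=0}^{d_x-1}W^\infty_{i+1,j+1}y^i$ ($0\le j\le d_x-1$), $[b^0_j]_j$ is an integral basis of the function field $\mathbf{Q}(X)$ over $\mathbf{Q}[x]$ and $[b^\infty_j]_j$ is one over $\mathbf{Q}[1/x]$. Good reduction of $(\mathcal{Q},W^0,W^\infty)$ at $p$ means: (1) the discriminant of $r$ is in $\mathbf{Z}_p^\times$; (2) the reductions mod $p$ of $[b^0_j]$ and $[b^\infty_j]$ are integral bases of $\mathrm{Frac}(\mathbf{F}_p[x,y]/(\mathcal{Q}))$ over $\mathbf{F}_p[x]$ and $\mathbf{F}_p[1/x]$ respectively; (3) $W^0\in\mathrm{GL}_{d_x}(\mathbf{Z}_p[x,1/r])$, $W^\infty\in\mathrm{GL}_{d_x}(\mathbf{Z}_p[x,1/x,1/r])$;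 (4) with $\mathcal{R}^0=\sum_j\mathbf{Z}_p[x]b^0_j$ and $\mathcal{R}^\infty=\sum_j\mathbf{Z}_p[1/x]b^\infty_j$, the discriminants of the finite $\mathbf{Z}_p$-algebras $(\mathcal{R}^0/(r(x)))_{\mathrm{red}}$ and $(\mathcal{R}^\infty/(1/x))_{\mathrm{red}}$ are in $\mathbf{Z}_p^\times$. Gluing $\mathrm{Spec}\,\mathcal{R}^0$ and $\mathrm{Spec}\,\mathcal{R}^\infty$ along the loci where $x$ is invertible gives a smooth curve $\mathcal{X}/\mathbf{Z}_p$ with $\mathcal{X}\otimes\mathbf{Q}_p\cong X\otimes\mathbf{Q}_p$. $X^{an}$ is its rigid analytic generic fibre; the fibres of the specialization map from $X^{an}$ to the reduction mod $p$ are the residue disks. A point is very infinite if $x=\infty$, and very bad if it is very infinite or $x$ is a zero of $r$. A residue disk (and any point in it) is bad (resp. infinite) if it contains a very bad (resp. very infinite) point, and good (resp. finite) otherwise. A residue disk contains at most one very bad point. Local coordinate. $t$ is a local coordinate at $P'$ not only on $X$ but on $\mathcal{X}$: its reduction mod $p$ is a local coordinate at the reduction of $P'$ and the residue disk of $P'$ is $|t|<1$. Concretely $t=x-x(P')$ (or $1/x$ if $P'$ is infinite) if the ramification index of $x$ at $P'$ is $1$, and otherwise $t=b^0_i-b^0_i(P')$ (with $b^\infty$ in place of $b^0$ if $P'$ is infinite) for a suitable $i$. Precision. Precision always means absolute $p$-adic precision, i.e. a computed value is correct (accurate) to precision $\nu$ if the $p$-adic valuation $\mathrm{ord}_p$ (extended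 to finite extensions of $\mathbf{Q}_p$, $\mathrm{ord}_p(p)=1$) of its difference with the true value is at least $\nu$. A point is represented by its $x$-value and the values of the $b^0_j$ (respectively $1/x$ and the $b^\infty_j$ for an infinite point); it is accurate to precision $N$ if these values are, so that $t(P)$, $t(Q)$ are known to precision $N$. That $g$ is accurate to precision $N$ means each coefficient $a_i$ is known to precision $N$. Inverting a computed value presupposes that it is nonzero to the given precision. Tiny integral. A Coleman integral between two points of the same residue disk; here $\int_P^Q\omega=\sum_{i\ge -k,\ i\ne -1}\frac{a_i}{i+1}\left(t(Q)^{i+1}-t(P)^{i+1}\right)$, where $a_{-1}=0$ because $\omega$ is of the second kind. The computed value is the same sum restricted to $i\le l-1$, evaluated with the approximate data. *)

(* Defs.v *)
From HB Require Import structures.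
From mathcomp Require Import all_boot all_order all_algebra all_field.
From mathcomp Require Import boolp classical_sets reals constructive_ereal ereal.

Set Implicit Arguments.
Unset Strict Implicit.
Unset Printing Implicit Defensive.

Import Order.TTheory GRing.Theory Num.Theory.
Local Open Scope classical_set_scope.
Local Open Scope ring_scope.

Local Notation "x %:F" := (tofrac x).

(** * Algebra *)

Definition irreducible_elt (A : idomainType) (a : A) : Prop :=
  [/\ a != 0, a \isn't a GRing.unit &
      forall b c : A, a = b * c -> b \is a GRing.unit \/ c \is a GRing.unit].

(* Divisibility in the ring itself: [%|] on {poly int} is pseudo-division,
   i.e. divisibility in rat[x]. *)
Definition dvd_elt (A : comNzRingType) (a b : A) : Prop := exists c, b = c * a.

Definition is_gcd (A : comNzRingType) (a b g : A) : Prop :=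
  [/\ dvd_elt g a, dvd_elt g b &
      forall c, dvd_elt c a -> dvd_elt c b -> dvd_elt c g].

(* disc(f) = (-1)^(n(n-1)/2) Res(f, f') / lc(f) with n = deg f. *)
Definition monic_disc (A : comNzRingType) (f : {poly A}) : A :=
  (-1) ^+ 'C((size f).-1, 2) * resultant f f^`().

Definition disc (f : {poly int}) : int := (monic_disc f %/ lead_coef f)%Z.

Definition coefs_in (k : nzRingType) (S : set k) (f : {poly k}) : Prop :=
  forall i, S f`_i.

(* The ideal I^n of the subring A, for an ideal I of A. *)
Fixpoint ideal_exp (F : nzRingType) (A I : set F) (n : nat) : set F :=
  if n is m.+1 then
    [set z | exists q (u v : 'I_q -> F),
       [/\ forall i, I (u i), forall i, ideal_exp A I m (v i)
         & z = \sum_i u i * v i]]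
  else A.

(* The exponent of the largest power of I / J (in A / J) containing the class
   of z is n; for A / J a Dedekind domain with maximal ideal I / J, this is the
   order of vanishing of z at the corresponding point. *)
Definition vanish_order (F : nzRingType) (A I J : set F) (n : nat) (z : F) :=
  let pow m := [set u + v | u in ideal_exp A I m & v in J] in
  pow n z /\ ~ pow n.+1 z.

(** * Function fields of plane curves *)

Notation ratfun k := {fraction {poly k}}.

Definition ratfun_map (k K : fieldType) (f : k -> K) (w : ratfun k) : ratfun K :=
  (map_poly f (\n_(repr w)))%:F / (map_poly f (\d_(repr w)))%:F.

(* k[x, 1/u] inside k(x), with coefficients in S *)
Definition localized (k : fieldType) (S : set k) (u : {poly k}) (w : ratfun k) :=
  exists n f, coefs_in S f /\ w = f%:F / u%:F ^+ n.

Definition GL_over (k : fieldType) (S : set k) (u : {poly k}) d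
    (W : 'M[ratfun k]_d) : Prop :=
  W \in unitmx /\
  forall i j, localized S u (W i j) /\ localized S u (invmx W i j).

Section FunctionField.
Variable Q : {poly {poly int}}.

(* The polynomials in y are the outer ones, so this is the degree in y. *)
Definition dx : nat := (size Q).-1.

Definition Qover (k : nzRingType) : {poly {poly k}} :=
  map_poly (map_poly (intr : int -> k)) Q.

Section OverField.
Variable k : fieldType.

(* k(x)[y] / (Q); for Q monic and irreducible over k this is
   Frac (k[x,y] / (Q)). *)
Definition funfield := {poly %/ map_poly (fun f => f%:F) (Qover k)}.

(* The element f(s) of the function field, for s in k(x). *)
Definition sub_at (s : ratfun k) (f : {poly k}) : funfield :=
  qpolyC _ (map_poly (fun c => (c%:P)%:F) f).[s].

Definition cst (c : k) : funfield := sub_at 0 c%:P.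

(* [true] stands for the chart around x = oo, whose coordinate is 1/x. *)
Definition chart_coord (infty : bool) : ratfun k :=
  if infty then ('X%:F)^-1 else 'X%:F.

Definition basis_of (W : 'M[ratfun k]_dx) (j : 'I_dx) : funfield :=
  \sum_(i < dx) W i j *: qpolyX _ ^+ i.

Definition comb (s : ratfun k) (b : 'I_dx -> funfield) (f : 'I_dx -> {poly k}) :=
  \sum_j sub_at s (f j) * b j.

(* b is a basis, over k[s], of the integral closure of k[s] *)
Definition integral_basis (s : ratfun k) (b : 'I_dx -> funfield) : Prop :=
  (forall z, integralOver (sub_at s) z <-> exists f, z = comb s b f) /\
  (forall f, comb s b f = 0 -> forall j, f j = 0).

End OverField.
End FunctionField.

Record triple := Triple {
  plane_eqn : {poly {poly int}};
  W0 : 'M[ratfun rat]_(dx plane_eqn);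
  Winf : 'M[ratfun rat]_(dx plane_eqn) }.

Definition chart_mx (T : triple) (infty : bool) := if infty then Winf T else W0 T.

Definition is_radical_disc (T : triple) (r : {poly int}) : Prop :=
  let Delta := monic_disc (plane_eqn T) in
  exists g, is_gcd Delta Delta^`() g /\ Delta = r * g.

Definition rover (r : {poly int}) (k : nzRingType) : {poly k} :=
  map_poly (intr : int -> k) r.

Definition bad_locus (r : {poly int}) (k : nzRingType) (infty : bool) : {poly k} :=
  if infty then 'X * rover r k else rover r k.

Definition curve_triple (T : triple) (r : {poly int}) : Prop :=
  [/\ irreducible_elt (plane_eqn T) /\ plane_eqn T \is monic,
      irreducible_elt (Qover (plane_eqn T) algC),
      is_radical_disc T r,
      forall infty, GL_over setT (bad_locus r rat infty) (chart_mx T infty)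
    & forall infty, integral_basis (chart_coord rat infty)
                      (basis_of (chart_mx T infty))].

Section Padic.
Variables (R : realType) (p : nat) (C : closedFieldType) (ord : C -> \bar R).
Local Open Scope ereal_scope.

(** * p-adic numbers *)

Definition ord_cvg (u : nat -> C) (z : C) : Prop :=
  forall M : nat, exists n0, forall n, (n0 <= n)%N -> M%:R%:E <= ord (u n - z).

(* Q_p is recovered as the closure of the rational numbers in C. *)
Definition padic_num : set C :=
  [set z | forall M : nat, exists q : rat, M%:R%:E <= ord (z - ratr q)].
Definition padic_int : set C := [set z | padic_num z /\ 0 <= ord z].
Definition padic_unit : set C := [set z | padic_num z /\ ord z = 0].

(* (C, ord) is an algebraic closure of Q_p with its valuation, normalised by
   ord p = 1. *)
Definition padic_closure : Prop :=
  [/\ [/\ forall z, ord z = +oo <-> z = 0%R,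
          forall z w, ord (z * w)%R = ord z + ord w,
          forall z w, mine (ord z) (ord w) <= ord (z + w)%R
        & ord p%:R = 1],
      (forall u : nat -> C, (forall n, padic_num (u n)) ->
        (forall M : nat, exists n0, forall m n, (n0 <= m)%N -> (n0 <= n)%N ->
           M%:R%:E <= ord (u m - u n)) ->
        exists z, ord_cvg u z)
    & forall z : C, exists f : {poly C},
        [/\ f != 0%R, coefs_in padic_num f & root f z]].

(* Q_p(varpi), which is Q_p[varpi] since varpi is algebraic *)
Definition padic_adjoin (varpi : C) : set C :=
  [set z | exists f : {poly C}, coefs_in padic_num f /\ z = f.[varpi]%R].

(** * Reduction modulo p *)

Definition reduces_to (z : C) (zbar : 'F_p) : Prop :=
  padic_int z /\ 0 < ord (z - (zbar : nat)%:R).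

Definition poly_reduces_to (f : {poly C}) (fbar : {poly 'F_p}) : Prop :=
  forall i, reduces_to f`_i%R fbar`_i%R.

(* The reduction map Z_p[x, 1/u] -> F_p[x, 1/ubar] *)
Definition ratfun_reduces_to (u : {poly C}) (ubar : {poly 'F_p})
    (w : ratfun C) (wbar : ratfun 'F_p) : Prop :=
  exists n f fbar, [/\ poly_reduces_to f fbar,
     w = (f%:F / u%:F ^+ n)%R & wbar = (fbar%:F / ubar%:F ^+ n)%R].

Section Curve.
Variables (T : triple) (r : {poly int}).
Local Notation Q := (plane_eqn T).
Local Notation d := (dx Q).
Local Notation FC := (funfield Q C).

Definition mx_over (infty : bool) : 'M[ratfun C]_d :=
  map_mx (ratfun_map (ratr : rat -> C)) (chart_mx T infty).
Definition chart_basis (infty : bool) : 'I_d -> FC := basis_of (mx_over infty).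
Definition coord_fun (infty : bool) : FC := sub_at Q (chart_coord C infty) 'X.

(* sum_j S[x] b^0_j, resp. sum_j S[1/x] b^oo_j *)
Definition chart_ring (S : set C) (infty : bool) : set FC :=
  [set z | exists f, (forall j, coefs_in S (f j)) /\
                     z = comb (chart_coord C infty) (chart_basis infty) f].

(** * Good reduction *)

(* The radical of the ideal u A of A, so that (A / u A)_red = A / rad A u. *)
Definition rad (A : set FC) (u : FC) : set FC :=
  [set z | A z /\ exists n w, A w /\ (z ^+ n = u * w)%R].

(* A / rad A u is a finite free Z_p-algebra, with basis the classes of e and
   structure constants m; its discriminant det (Tr (e_i e_j)) is a unit. *)
Definition red_disc_unit (A : set FC) (u : FC) : Prop :=
  exists q (e : 'I_q -> FC) (m : 'I_q -> 'I_q -> 'I_q -> C),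
    let lin (c : 'I_q -> C) := (\sum_i cst Q (c i) * e i)%R in
    let tr (c : 'I_q -> C) := (\sum_i c i * \sum_j m i j j)%R in
    [/\ (forall i, A (e i)),
        (forall z, A z ->
           exists c, (forall i, padic_int (c i)) /\ rad A u (z - lin c)%R),
        (forall c, (forall i, padic_int (c i)) -> rad A u (lin c) ->
           forall i, c i = 0%R),
        (forall i j, (forall n, padic_int (m i j n)) /\
           rad A u (e i * e j - lin (m i j))%R)
      & padic_unit (\det (\matrix_(i, j) tr (m i j)))].

Definition good_reduction : Prop :=
  [/\ padic_unit (disc r)%:~R,
      (* Q must be irreducible mod p for Frac (F_p[x,y] / (Q)) to make sense. *)
      irreducible_elt (Qover Q 'F_p) /\
      (forall infty, exists Wbar : 'M[ratfun 'F_p]_d,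
         (forall i j, ratfun_reduces_to (bad_locus r C infty)
            (bad_locus r 'F_p infty) (mx_over infty i j) (Wbar i j)) /\
         integral_basis (chart_coord 'F_p infty) (basis_of Wbar)),
      (forall infty, GL_over padic_int (bad_locus r C infty) (mx_over infty)),
      red_disc_unit (chart_ring padic_int false)
        (sub_at Q (chart_coord C false) (rover r C))
    & red_disc_unit (chart_ring padic_int true) (coord_fun true)].

(** * Points and residue disks *)

(* The values of x and of the b^0_j, or of 1/x and of the b^oo_j when
   [at_infty] holds. *)
Record cpoint := CPoint {
  at_infty : bool;
  xval : C;
  bval : 'I_d -> C }.

Definition value (P : cpoint) (z : FC) (c : C) : Prop :=
  exists f, z = comb (chart_coord C (at_infty P)) (chart_basis (at_infty P)) f /\
            c = (\sum_j (f j).[xval P] * bval P j)%R.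

(* P belongs to X(C): evaluation at P is a C-algebra homomorphism from the
   coordinate ring of the affine chart to C. Each point is represented once: in
   the chart around x = oo if it reduces to a point over x = oo, and in the
   other chart if not. *)
Definition is_point (P : cpoint) : Prop :=
  [/\ value P 1%R 1%R,
      (forall z w c c', value P z c -> value P w c' -> value P (z * w)%R (c * c')%R)
    & if at_infty P then 0 < ord (xval P) else 0 <= ord (xval P)].

Definition point_over (K : set C) (P : cpoint) : Prop :=
  [/\ is_point P, K (xval P) & forall j, K (bval P j)].

(* P and P' have the same reduction in the special fibre. *)
Definition same_disk (P P' : cpoint) : Prop :=
  [/\ at_infty P = at_infty P', 0 < ord (xval P - xval P')
    & forall j, 0 < ord (bval P j - bval P' j)].

Definition very_infinite (P : cpoint) : Prop := at_infty P /\ xval P = 0%R.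

Definition very_bad (P : cpoint) : Prop :=
  very_infinite P \/
  root (rover r C) (if at_infty P then (xval P)^-1 else xval P)%R.

Definition bad_disk (P : cpoint) : Prop :=
  exists P', [/\ is_point P', same_disk P P' & very_bad P'].

(** * Local coordinates *)

Definition max_ideal (P : cpoint) : set FC := [set z | value P z 0%R].

Definition order_at (P : cpoint) (n : nat) (z : FC) : Prop :=
  vanish_order (chart_ring setT (at_infty P)) (max_ideal P) [set 0%R] n z.

(* Order of vanishing at the reduction of P, on the special fibre (over the
   residue field of C) *)
Definition red_order_at (P : cpoint) (n : nat) (z : FC) : Prop :=
  let A := chart_ring [set c | 0 <= ord c] (at_infty P) in
  vanish_order A [set w | A w /\ exists c, value P w c /\ 0 < ord c]
    (chart_ring [set c | 0 < ord c] (at_infty P)) n z.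

Definition ramification_index (P : cpoint) (n : nat) : Prop :=
  order_at P n (coord_fun (at_infty P) - cst Q (xval P))%R.

(* Candidates for the local coordinate at P: [None] is x - x(P), [Some i] is
   b^0_i - b^0_i(P); if P is infinite 1/x and b^oo_i replace x and b^0_i. *)
Definition tfun (P : cpoint) (i : option 'I_d) : FC :=
  if i is Some j then (chart_basis (at_infty P) j - cst Q (bval P j))%R
  else (coord_fun (at_infty P) - cst Q (xval P))%R.

(* The value of [tfun P i] at a point P1 of the same chart *)
Definition tcoord (P : cpoint) (i : option 'I_d) (P1 : cpoint) : C :=
  if i is Some j then (bval P1 j - bval P j)%R else (xval P1 - xval P)%R.

Definition local_coord (P : cpoint) (i : option 'I_d) : Prop :=
  [/\ i = None <-> ramification_index P 1,
      order_at P 1 (tfun P i),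
      red_order_at P 1 (tfun P i)
    & forall c : C, 0 < ord c -> exists! P1,
        [/\ is_point P1, same_disk P P1 & tcoord P i P1 = c]].

(** * Differentials *)

(* The derivation d/dx of the function field *)
Definition is_ddx (D : FC -> FC) : Prop :=
  [/\ forall z w, D (z + w)%R = (D z + D w)%R,
      forall z w, D (z * w)%R = (D z * w + z * D w)%R,
      forall c, D (cst Q c) = 0%R
    & D (coord_fun false) = 1%R].

(* G = sum_(i >= -k) a_i t^i in the completed local ring at P, with t a
   uniformizer at P: for all n, (t^k G - sum_(i < n) a_(i-k) t^i) / t^n is
   regular at P, that is, of the form z / w with w(P) <> 0. *)
Definition laurent (P : cpoint) (t : FC) (k : nat) (a : int -> C) (G : FC) :=
  forall n : nat, exists z w c,
    [/\ chart_ring setT (at_infty P) z, value P w c, c <> 0%R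
      & (w * (t ^+ k * G - \sum_(i < n) cst Q (a (i%:Z - k%:Z)) * t ^+ i)
         = t ^+ n * z)%R].

(* The differential h dx equals (sum_(i >= -k) a_i t^i) dt at P. *)
Definition diff_expansion (h : FC) (P : cpoint) (t : FC) (k : nat) (a : int -> C) :=
  exists D G, [/\ is_ddx D, h = (G * D t)%R & laurent P t k a G].

(* All the residues of h dx vanish. *)
Definition second_kind (h : FC) : Prop :=
  forall P t k a, is_point P -> order_at P 1 t -> (0 < k)%N ->
    diff_expansion h P t k a -> a (-1)%R = 0%R.

(** * Precision and tiny integrals *)

Definition accurate (N : nat) (approx z : C) : Prop := N%:R%:E <= ord (approx - z).

Definition accurate_point (N : nat) (P1 P : cpoint) : Prop :=
  [/\ at_infty P1 = at_infty P, accurate N (xval P1) (xval P)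
    & forall j, accurate N (bval P1 j) (bval P j)].

End Curve.

(* The sum over -k <= i < n - k of the integrated terms *)
Definition partial_integral (a : int -> C) (k : nat) (tP tQ : C) (n : nat) : C :=
  (\sum_(j < n) let i := j%:Z - k%:Z in
     if i == -1 then 0 else a i / (i + 1)%:~R * (tQ ^ (i + 1) - tP ^ (i + 1)))%R.

Definition tiny_integral (a : int -> C) (k : nat) (tP tQ I : C) : Prop :=
  ord_cvg (partial_integral a k tP tQ) I.

Variables (e N k l : nat).

Definition slope (i : nat) : \bar R :=
  (i%:R / e%:R - (trunc_log p i.+1)%:R)%:E.

Definition nu1 : \bar R :=
  (e%:R^-1)%:E + ereal_inf [set slope i | i in [set i | (l <= i)%N]].

(* The infimum over the empty set, for l = 0, is +oo. *)
Definition nu2 : \bar R :=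
  N%:R%:E + ereal_inf [set slope i | i in [set i | (i < l)%N]].

Definition nu3 (tP tQ : C) : \bar R :=
  if k == 1%N then +oo
  else N%:R%:E - k%:R%:E * maxe (ord tP) (ord tQ) - (trunc_log p k.-1)%:R%:E.

End Padic.

(* Main.v *)
(** In a bad disk the very bad point P' is the unique one, hence should have
    p-adic coordinates; the proof of this is the only use of good reduction.
    Evaluation at P' factors through a finite free Z_p-algebra B with unimodular
    trace form, so it is the trace pairing with an idempotent of B, and Newton's
    method in B converges to it from Z_p-coordinates, because P' has the same
    reduction as P, which is defined over F_p. In the infinite chart one also has
    to see that x(P') = oo, i.e. that every root of r is integral: evaluating the
    finite chart at a point over a non-integral root x0 would make x0^n b_j
    integral for all n.

    Thus t(P) and t(Q) lie in the maximal ideal of Q_p(p^(1/e)), which is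
    complete with value group (1/e)Z, so that t(P) and t(Q) have valuation at
    least 1/e. The three bounds come from the tail (nu1), the nonnegative powers
    of t (nu2) and the polar part (nu3); only the last one sees the loss of
    precision in inverting t. *)

Require Import Defs.
From HB Require Import structures.
From mathcomp Require Import all_boot all_order all_algebra all_field.
From mathcomp Require Import boolp classical_sets reals constructive_ereal ereal.
From mathcomp Require Import ring lra zify.

Set Implicit Arguments.
Unset Strict Implicit.
Unset Printing Implicit Defensive.

Import Order.TTheory GRing.Theory Num.Theory.
Local Open Scope classical_set_scope.
Local Open Scope ring_scope.

(** The integral bases are given over Q, while points have coordinates in C. What is transported to
    C are the expansions of 1, of products of basis elements, and of finite-chart functions
    multiplied by a power of 1/x. Their coefficients are only known to be rational, so that over Z_p
    a chart ring is not visibly closed under products: computations modulo the radical take place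
    over Q_p, and powers of p are cleared to return to Z_p. The idempotent w of a point phi of B is
    the solution of Tr(w b) = phi(b) for all b. Nondegeneracy of the trace form gives b w = phi(b)
    w, and then phi(w) = 1. If h is the error of an approximation to the values t_i = phi(e_i), the
    defect of multiplicativity determines t_i h_j + h_i t_j - sum_n m_ijn h_n to first order.
    Contracted with w over i, the last two terms cancel and h_j remains; no Jacobian has to be
    inverted. *)

(** * Rational numbers in a field of characteristic zero *)

Lemma ratr_zmod_morphism (F : fieldType) (char0 : forall n, (n.+1)%:R != 0 :> F) :
  zmod_morphism (@ratr F).
Proof.
have intr0 (z : int) : z != 0 -> z%:~R != 0 :> F.
  by case: z => [[|n]|n] // _; rewrite ?NegzE ?mulrNz ?oppr_eq0; exact: char0.
have injZ : injective (fun z : int => z%:~R : F).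
  move=> x y /eqP; rewrite -subr_eq0 -rmorphB => e; apply/eqP; rewrite -subr_eq0.
  by apply: contraTT e => /intr0.
move=> x y; have nzd z : (denq z)%:~R != 0 :> F by rewrite intr0 ?denq_neq0.
apply: (canLR (mulfK (nzd _))).
apply: (mulIf (nzd x)); apply: (mulIf (nzd y)).
rewrite /ratr !mulrBl.
have -> : (numq x)%:~R / (denq x)%:~R * (denq (x - y))%:~R * (denq x)%:~R * (denq y)%:~R
   = (numq x * denq (x - y) * denq y)%:~R :> F.
  by rewrite !rmorphM /=; field; rewrite nzd.
have -> : (numq y)%:~R / (denq y)%:~R * (denq (x - y))%:~R * (denq x)%:~R * (denq y)%:~R
   = (numq y * denq (x - y) * denq x)%:~R :> F.
  by rewrite !rmorphM /=; field; rewrite nzd.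
(* With the denominators cleared, an identity between integers is left; it is checked in [rat]. *)
rewrite -!rmorphM -rmorphB /=; congr (_%:~R); apply: (@intr_inj rat).
rewrite rmorphB !rmorphM /= !numqE; ring.
Qed.

Lemma ratr_monoid_morphism (F : fieldType) (char0 : forall n, (n.+1)%:R != 0 :> F) :
  monoid_morphism (@ratr F).
Proof.
have intr0 (z : int) : z != 0 -> z%:~R != 0 :> F.
  by case: z => [[|n]|n] // _; rewrite ?NegzE ?mulrNz ?oppr_eq0; exact: char0.
split=> [|x y]; first by rewrite /ratr divr1.
have nzd z : (denq z)%:~R != 0 :> F by rewrite intr0 ?denq_neq0.
apply: (canLR (mulfK (nzd _))).
apply: (mulIf (nzd x)); apply: (mulIf (nzd y)).
rewrite /ratr.
have -> : (numq x)%:~R / (denq x)%:~R * ((numq y)%:~R / (denq y)%:~R) *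
    (denq (x * y))%:~R * (denq x)%:~R * (denq y)%:~R
   = (numq x * numq y * denq (x * y))%:~R :> F.
  by rewrite !rmorphM /=; field; rewrite !nzd.
rewrite -!rmorphM /=; congr (_%:~R); apply: (@intr_inj rat).
rewrite !rmorphM /= !numqE; ring.
Qed.

(** * The valuation *)

Section Valuation.
Variables (R : realType) (p : nat) (C : closedFieldType) (ord : C -> \bar R).
Hypotheses (hp : prime p) (hC : padic_closure p ord).

(** [vge] also covers z = 0, where the order is infinite; [padic_val] is real-valued and takes the
    default value 0 there, whence the conditions z != 0 below. *)
Definition vge (x : R) (z : C) : Prop := (x%:E <= ord z)%E.
Definition padic_val (z : C) : R := fine (ord z).
Local Notation v := padic_val.

Lemma ord_eq0 z : ord z = +oo%E <-> z = 0. Proof. by case: hC => -[]. Qed.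
Lemma ordM z w : ord (z * w) = (ord z + ord w)%E. Proof. by case: hC => -[]. Qed.
Lemma ordD z w : (Order.min (ord z) (ord w) <= ord (z + w))%E.
Proof. by case: hC => -[]. Qed.
Lemma ord_p : ord p%:R = 1%E. Proof. by case: hC => -[]. Qed.

Lemma ord_zero : ord 0 = +oo%E. Proof. exact/ord_eq0. Qed.

Lemma ord_one : ord 1 = 0%E.
Proof.
have := ordM 1 1; rewrite mulr1; have := ordM 1 p%:R; rewrite mul1r ord_p.
case E: (ord 1) => [x| |] //=.
by move=> _ [] e; congr (_%:E); lra.
Qed.

(** The value -oo is excluded by ord z + ord z^-1 = 0. *)
Lemma ordE z : z != 0 -> ord z = (v z)%:E.
Proof.
move=> nz; rewrite /v; have := ordM z z^-1; rewrite divff // ord_one.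
case E: (ord z) => [x| |] //=.
by move: E nz => /ord_eq0 ->; rewrite eqxx.
Qed.

Lemma vgeE x z : z != 0 -> vge x z <-> x <= v z.
Proof. by move=> nz; rewrite /vge ordE // lee_fin. Qed.

Lemma vgev z : vge (v z) z.
Proof.
have [->|nz] := eqVneq z 0; first by rewrite /vge ord_zero leey.
exact/vgeE.
Qed.

Lemma vM z w : z != 0 -> w != 0 -> v (z * w) = v z + v w.
Proof. by move=> nz nw; rewrite {1}/padic_val ordM !ordE. Qed.

Lemma v1 : v 1 = 0. Proof. by rewrite /padic_val ord_one. Qed.

Lemma vV z : z != 0 -> v z^-1 = - v z.
Proof.
move=> nz; have := v1; rewrite -(divff nz) vM ?invr_neq0 //.
by move/eqP; rewrite addrC addr_eq0 => /eqP.
Qed.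

Lemma vX z n : z != 0 -> v (z ^+ n) = n%:R * v z.
Proof.
move=> nz; elim: n => [|n IH]; first by rewrite mul0r v1.
by rewrite exprS vM ?expf_neq0 // IH mulrS mulrDl mul1r.
Qed.

Lemma vp : v p%:R = 1. Proof. by rewrite /padic_val ord_p. Qed.

Lemma p_neq0 : p%:R != 0 :> C.
Proof. by apply/eqP => /ord_eq0; rewrite ord_p. Qed.

Lemma vge0 x : vge x 0. Proof. by rewrite /vge ord_zero leey. Qed.

Lemma vge_mono x y z : y <= x -> vge x z -> vge y z.
Proof. by move=> yx; apply: le_trans; rewrite lee_fin. Qed.

Lemma vgeD x z w : vge x z -> vge x w -> vge x (z + w).
Proof. by move=> hz hw; apply: le_trans (ordD z w); rewrite le_min; apply/andP. Qed.

Lemma vgeM x y z w : vge x z -> vge y w -> vge (x + y) (z * w).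
Proof.
have [->|nz] := eqVneq z 0; first by rewrite mul0r => *; exact: vge0.
have [->|nw] := eqVneq w 0; first by rewrite mulr0 => *; exact: vge0.
by rewrite !vgeE ?mulf_neq0 // vM //; exact: lerD.
Qed.

Lemma vge1 : vge 0 1. Proof. by rewrite /vge ord_one. Qed.

Lemma vgeN x z : vge x z -> vge x (- z).
Proof.
have n10 : - 1 != 0 :> C by rewrite oppr_eq0 oner_eq0.
have vN1 : v (- 1) = 0.
  have := vM n10 n10; rewrite mulrNN mulr1 v1 => /eqP.
  by rewrite -mulr2n eq_sym mulrn_eq0 => /eqP.
move=> h; rewrite -mulN1r -[x]add0r; apply: vgeM => //.
by rewrite -vN1; exact: vgev.
Qed.

Lemma vgeB x z w : vge x z -> vge x w -> vge x (z - w).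
Proof. by move=> hz /vgeN; exact: vgeD. Qed.

Lemma vge_sum x (I : Type) (s : seq I) (P : pred I) (F : I -> C) :
  (forall i, P i -> vge x (F i)) -> vge x (\sum_(i <- s | P i) F i).
Proof. move=> h; apply: big_ind => //; [exact: vge0 | exact: vgeD]. Qed.

Lemma vgeX z n : vge 0 z -> vge 0 (z ^+ n).
Proof.
move=> h; elim: n => [|n IH]; first exact: vge1.
by rewrite exprS -[0]addr0; exact: vgeM.
Qed.

Lemma vgeMl x z w : vge 0 z -> vge x w -> vge x (z * w).
Proof. by move=> hz hw; rewrite -[x]add0r; exact: vgeM. Qed.

Lemma vgeMr x z w : vge x z -> vge 0 w -> vge x (z * w).
Proof. by move=> hz hw; rewrite -[x]addr0; exact: vgeM. Qed.

Lemma vge_nat n : vge 0 n%:R.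
Proof. by elim: n => [|n IH]; [exact: vge0 | rewrite mulrS; exact: vgeD vge1 IH]. Qed.

Lemma nat_real (x : R) : exists n : nat, x <= n%:R.
Proof.
by exists (Num.truncn `|x|).+1; apply: le_trans (ler_norm _) _; apply/ltW/truncnS_gt.
Qed.

(** The equality case of the ultrametric inequality. It carries valuations from p-adic numbers to
    rational approximations, and from the computed parameter to the true one in [nu3_bound]. *)
Lemma v_near z w x : w != 0 -> v w < x -> vge x (z - w) -> z != 0 /\ v z = v w.
Proof.
move=> nw lt h; have nz : z != 0.
  apply: contraTneq lt => z0; rewrite -leNgt; apply/vgeE => //.
  by rewrite -[w]opprK; apply: vgeN; rewrite -sub0r -z0.
split => //; apply/eqP; rewrite eq_le; apply/andP; split.
  rewrite leNgt; apply/negP => lt2.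
  have : vge (Num.min x (v z)) w.
    rewrite -[w](subKr z); apply: vgeB.
      by apply: vge_mono (vgev z); rewrite ge_min lexx orbT.
    by apply: vge_mono h; rewrite ge_min lexx.
  by rewrite vgeE // leNgt lt_min lt lt2.
rewrite -[z](subrK w); apply/vgeE; first by rewrite subrK.
by apply: vgeD (vgev w); apply: vge_mono h; exact: ltW.
Qed.

Lemma pos_vge z : (0 < ord z)%E <-> exists2 x, 0 < x & vge x z.
Proof.
split=> [h|[x x0 h]]; last by apply: lt_le_trans h; rewrite lte_fin.
have [->|nz] := eqVneq z 0; first by exists 1; rewrite ?ltr01 //; exact: vge0.
by exists (v z); [rewrite -lte_fin -ordE | exact: vgev].
Qed.

(** By a Bezout relation 1 = a p - b m, a positive valuation of m would make that of 1 positive. *)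
Lemma coprime_unit (m : nat) : coprime p m -> m%:R != 0 :> C /\ v m%:R = 0.
Proof.
move=> cop; have pgt := prime_gt0 hp.
have [a b e _] := egcdnP m pgt; move: e; rewrite (eqP cop) => e.
have e1 : 1 = a%:R * p%:R - b%:R * m%:R :> C.
  by rewrite -!natrM e natrD addrAC subrr add0r.
have nm : m%:R != 0 :> C.
  apply/eqP => m0; move: e1; rewrite m0 mulr0 subr0 => e1.
  have : vge 1 1.
    rewrite [X in vge _ X]e1.
    by apply: vgeMl; [exact: vge_nat | rewrite /vge ord_p].
  by rewrite /vge ord_one lee_fin ler10.
split => //; apply/eqP; rewrite eq_le -[0 <= _]/(0 <= v m%:R).
apply/andP; split; last by apply/vgeE => //; exact: vge_nat.
rewrite leNgt; apply/negP => vpos.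
have : vge (Num.min 1 (v m%:R)) (a%:R * p%:R - b%:R * m%:R).
  apply: vgeB; apply: vgeMl; try exact: vge_nat.
    by apply: (@vge_mono 1); [rewrite ge_min lexx | rewrite /vge ord_p].
  by apply: vge_mono (vgev _); rewrite ge_min lexx orbT.
by rewrite -e1 /vge ord_one lee_fin leNgt lt_min ltr01 vpos.
Qed.

Lemma v_nat n : (0 < n)%N -> n%:R != 0 :> C /\ v n%:R = (logn p n)%:R.
Proof.
move=> n0; have [m cop ->] := pfactor_coprime hp n0.
have [nm vm] := coprime_unit cop.
rewrite natrM natrX; split; first by rewrite mulf_neq0 // expf_neq0 // p_neq0.
rewrite vM ?expf_neq0 ?p_neq0 // vX ?p_neq0 // vp mulr1 vm add0r.
have m0 : (0 < m)%N by rewrite lt0n; apply: contraNneq nm => ->.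
by rewrite lognM ?expn_gt0 ?(prime_gt0 hp) // pfactorK // (logn_coprime cop).
Qed.

Lemma natC_neq0 n : (n.+1)%:R != 0 :> C. Proof. by have [] := v_nat (ltn0Sn n). Qed.

Definition ratrC : {rmorphism rat -> C} :=
  HB.pack (@ratr C)
    (GRing.isZmodMorphism.Build _ _ _ (ratr_zmod_morphism natC_neq0))
    (GRing.isMonoidMorphism.Build _ _ _ (ratr_monoid_morphism natC_neq0)).

Lemma v_rat q : q != 0 -> exists z : int, v (ratrC q) = z%:~R.
Proof.
have aux (z : int) : z != 0 -> z%:~R != 0 :> C /\ exists n : nat, v z%:~R = n%:R.
  case: z => [[|n]|n] // _; have [nz vn] := v_nat (ltn0Sn n).
    by split=> //; exists (logn p n.+1).
  rewrite NegzE mulrNz oppr_eq0; split=> //; exists (logn p n.+1).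
  rewrite -[in RHS]vn; apply/eqP.
  have nz' : - n.+1%:R != 0 :> C by rewrite oppr_eq0.
  rewrite eq_le; apply/andP; split; apply/vgeE => //.
    by rewrite -[n.+1%:R]opprK; apply: vgeN; exact: vgev.
  by apply: vgeN; exact: vgev.
move=> nq; have [nd [b vb]] := aux _ (denq_neq0 q).
have [|nn [a va]] := aux (numq q); first by rewrite numq_eq0.
exists (a%:Z - b%:Z); rewrite /= /ratr vM ?invr_neq0 // vV // va vb.
by rewrite rmorphB.
Qed.

Lemma ratrC_neq0 q : (ratrC q == 0) = (q == 0).
Proof. exact: fmorph_eq0. Qed.

(** * p-adic numbers *)

Local Notation Qp := (padic_num ord).
Local Notation Zp := (padic_int ord).

Lemma padic_num_rat q : Qp (ratrC q).
Proof. by move=> M; exists q; rewrite subrr; exact: vge0. Qed.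

Lemma padic_num_nat n : Qp n%:R.
Proof. by rewrite -(rmorph_nat ratrC); exact: padic_num_rat. Qed.
Lemma padic_num0 : Qp 0. Proof. exact: (padic_num_nat 0). Qed.
Lemma padic_num1 : Qp 1. Proof. exact: (padic_num_nat 1). Qed.

Lemma padic_num_approx z x : Qp z -> exists q, vge x (z - ratrC q).
Proof.
move=> hz; have [M hM] := nat_real x; have [q hq] := hz M.
by exists q; exact: vge_mono hM hq.
Qed.

Lemma padic_num_intro z : (forall M : nat, exists2 w, Qp w & vge M%:R (z - w)) -> Qp z.
Proof.
move=> h M; have [w hw hzw] := h M; have [q hq] := hw M.
by exists q; rewrite -[z](subrK w) -addrA; exact: vgeD.
Qed.

Lemma padic_numD z w : Qp z -> Qp w -> Qp (z + w).
Proof.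
move=> hz hw M; have [q hq] := hz M; have [q' hq'] := hw M.
exists (q + q'); rewrite -[ratr _]/(ratrC _) rmorphD opprD addrACA.
exact: vgeD.
Qed.

Lemma padic_numM z w : Qp z -> Qp w -> Qp (z * w).
Proof.
move=> hz hw M.
have [q' hq'] := padic_num_approx (M%:R - v z) hw.
have [q hq] := padic_num_approx (M%:R - v (ratrC q')) hz.
exists (q * q'); rewrite -[ratr _]/(ratrC _) rmorphM.
have -> : z * w - ratrC q * ratrC q' = z * (w - ratrC q') + (z - ratrC q) * ratrC q' by ring.
apply: vgeD.
  by rewrite -[M%:R](addrNK (v z)) addrC; exact: vgeM (vgev z) hq'.
by rewrite -[M%:R](addrNK (v (ratrC q'))); exact: vgeM hq (vgev _).
Qed.

Lemma padic_numN z : Qp z -> Qp (- z).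
Proof.
by move=> hz; rewrite -mulN1r -(rmorph1 ratrC) -rmorphN; apply: padic_numM => //; exact: padic_num_rat.
Qed.

Lemma padic_numV z : Qp z -> Qp z^-1.
Proof.
have [->|nz] := eqVneq z 0; first by rewrite invr0.
(* The first bound makes q nonzero with the valuation of z; the second allows for the factor 1/(z q)
   in 1/z - 1/q, of valuation -2 v z. *)
move=> hz M; have [q hq] := padic_num_approx (Num.max (v z + 1) (M%:R + v z + v z)) hz.
have hq' : vge (Num.max (v z + 1) (M%:R + v z + v z)) (ratrC q - z).
  by rewrite -opprB; exact: vgeN.
have [nq vq] : ratrC q != 0 /\ v (ratrC q) = v z.
  by apply: v_near hq' => //; rewrite lt_max ltrDl ltr01.
exists q^-1; rewrite -[ratr _]/(ratrC _) fmorphV.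
have -> : z^-1 - (ratrC q)^-1 = (ratrC q - z) * (z^-1 * (ratrC q)^-1).
  by move: nq; move: (ratrC q) => y ny; field; apply/andP.
have -> : M%:R = M%:R + v z + v z + (- v z - v z) by ring.
apply: vgeM; first by apply: vge_mono hq'; rewrite le_max lexx orbT.
apply: vgeM; first by rewrite -vV //; exact: vgev.
by rewrite -vq -vV //; exact: vgev.
Qed.

Lemma padic_numB z w : Qp z -> Qp w -> Qp (z - w).
Proof. by move=> hz /padic_numN; exact: padic_numD. Qed.

Lemma padic_num_sum (I : Type) (s : seq I) (P : pred I) (F : I -> C) :
  (forall i, P i -> Qp (F i)) -> Qp (\sum_(i <- s | P i) F i).
Proof. by move=> h; apply: big_ind => //; [exact: padic_num0 | exact: padic_numD]. Qed.

Lemma padic_numX z n : Qp z -> Qp (z ^+ n).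
Proof.
by move=> h; elim: n => [|n IH]; [exact: padic_num1 | rewrite exprS; exact: padic_numM].
Qed.

Lemma v_Qp z : Qp z -> z != 0 -> exists n : int, v z = n%:~R.
Proof.
move=> hz nz; have [q hq] := padic_num_approx (v z + 1) hz.
have [nq vq] : ratrC q != 0 /\ v (ratrC q) = v z.
  by apply: (@v_near _ _ (v z + 1)) => //; rewrite ?ltrDl // -opprB; exact: vgeN.
by rewrite -vq; apply: v_rat; rewrite -ratrC_neq0.
Qed.

Lemma padic_intD z w : Zp z -> Zp w -> Zp (z + w).
Proof. by move=> [q h] [q' h']; split; [exact: padic_numD | exact: vgeD]. Qed.
Lemma padic_intM z w : Zp z -> Zp w -> Zp (z * w).
Proof. by move=> [q h] [q' h']; split; [exact: padic_numM | exact: vgeMl]. Qed.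
Lemma padic_intN z : Zp z -> Zp (- z).
Proof. by move=> [q h]; split; [exact: padic_numN | exact: vgeN]. Qed.
Lemma padic_intB z w : Zp z -> Zp w -> Zp (z - w).
Proof. by move=> hz /padic_intN; exact: padic_intD. Qed.
Lemma padic_int_nat n : Zp n%:R. Proof. by split; [exact: padic_num_nat | exact: vge_nat]. Qed.
Lemma padic_int0 : Zp 0. Proof. exact: (padic_int_nat 0). Qed.
Lemma padic_int1 : Zp 1. Proof. exact: (padic_int_nat 1). Qed.
Lemma padic_int_sum (I : Type) (s : seq I) (P : pred I) (F : I -> C) :
  (forall i, P i -> Zp (F i)) -> Zp (\sum_(i <- s | P i) F i).
Proof. by move=> h; apply: big_ind => //; [exact: padic_int0 | exact: padic_intD]. Qed.
Lemma padic_intX z n : Zp z -> Zp (z ^+ n).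
Proof. by move=> [q h]; split; [exact: padic_numX | exact: vgeX]. Qed.
Lemma padic_int_prod (I : Type) (s : seq I) (P : pred I) (F : I -> C) :
  (forall i, P i -> Zp (F i)) -> Zp (\prod_(i <- s | P i) F i).
Proof. by move=> h; apply: big_ind => //; [exact: padic_int1 | exact: padic_intM]. Qed.

Lemma padic_num_scale_Zp z : Qp z -> exists m : nat, Zp (p%:R ^+ m * z).
Proof.
move=> hz; have [m hm] := nat_real (- v z); exists m; split.
  by apply: padic_numM => //; apply: padic_numX; exact: padic_num_nat.
apply: (@vge_mono (m%:R + v z)); first by lra.
apply: vgeM (vgev z); apply/vgeE; first by rewrite expf_neq0 // p_neq0.
by rewrite vX ?p_neq0 // vp mulr1.
Qed.

End Valuation.

(** * The field Q_p(varpi) *)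

Section Ramified.
Variables (R : realType) (p : nat) (C : closedFieldType) (ord : C -> \bar R).
Hypotheses (hp : prime p) (hC : padic_closure p ord).

Local Notation Qp := (padic_num ord).
Local Notation Zp := (padic_int ord).
Local Notation vge := (vge ord).
Local Notation v := (padic_val ord).

Lemma posD z w : (0 < ord z)%E -> (0 < ord w)%E -> (0 < ord (z + w))%E.
Proof. by move=> hz hw; apply: lt_le_trans (ordD hC z w); rewrite lt_min hz. Qed.

Lemma posMl z w : vge 0 z -> (0 < ord w)%E -> (0 < ord (z * w))%E.
Proof.
by move=> hz /(pos_vge hC)[x x0 hw]; apply/(pos_vge hC); exists x => //; exact: (vgeMl hC).
Qed.

Lemma posMr z w : (0 < ord z)%E -> vge 0 w -> (0 < ord (z * w))%E.
Proof. by move=> hz hw; rewrite mulrC; exact: posMl. Qed.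

Lemma pos_vge0 z : (0 < ord z)%E -> vge 0 z.
Proof. exact: ltW. Qed.

Lemma posN z : (0 < ord z)%E -> (0 < ord (- z))%E.
Proof.
by move=> /(pos_vge hC)[x x0 hz]; apply/(pos_vge hC); exists x => //; exact: (vgeN hC).
Qed.

Lemma posC z w : (0 < ord (z - w))%E -> (0 < ord (w - z))%E.
Proof. by move/posN; rewrite opprB. Qed.

Lemma pos0 : (0 < ord 0)%E. Proof. by rewrite (ord_zero hC). Qed.

(** The integral elements with residue class in F_p; Newton's method can start from their
    approximations in Z_p. *)
Definition near_Zp (z : C) : Prop := exists2 a, Zp a & (0 < ord (z - a))%E.

Lemma near_ZpD z w : near_Zp z -> near_Zp w -> near_Zp (z + w).
Proof.
move=> [a ha hz] [b hb hw]; exists (a + b); first exact: (padic_intD hp hC).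
by rewrite opprD addrACA; exact: posD.
Qed.

Lemma near_ZpZp z : Zp z -> near_Zp z.
Proof. by move=> hz; exists z => //; rewrite subrr; exact: pos0. Qed.

Lemma near_Zp_int z : near_Zp z -> vge 0 z.
Proof.
by move=> [a [_ ha] /pos_vge0 hz]; rewrite -[z](subrK a); exact: (vgeD hC).
Qed.

Lemma near_ZpM z w : near_Zp z -> near_Zp w -> near_Zp (z * w).
Proof.
move=> nz nw; have hz0 := near_Zp_int nz.
case: nz nw => [a ha hz] [b hb hw].
exists (a * b); first exact: (padic_intM hp hC).
have -> : z * w - a * b = z * (w - b) + (z - a) * b by ring.
by apply: posD; [exact: posMl | apply: posMr hz _; case: hb].
Qed.

Lemma near_Zp_shift z w : near_Zp w -> (0 < ord (z - w))%E -> near_Zp z.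
Proof.
by move=> [a ha hw] hz; exists a => //; rewrite -[z](subrK w) -addrA; exact: posD.
Qed.

Lemma near_Zp_sum (I : Type) (s : seq I) (P : pred I) (F : I -> C) :
  (forall i, P i -> near_Zp (F i)) -> near_Zp (\sum_(i <- s | P i) F i).
Proof.
move=> h; apply: big_ind => //; [exact/near_ZpZp/(padic_int0 hp hC) | exact: near_ZpD].
Qed.

Lemma near_ZpX z n : near_Zp z -> near_Zp (z ^+ n).
Proof.
move=> h; elim: n => [|n IH]; first exact/near_ZpZp/(padic_int1 hp hC).
by rewrite exprS; exact: near_ZpM.
Qed.

Lemma gt_ord_sum (x : R) (I : Type) (s : seq I) (P : pred I) (F : I -> C) :
  (forall i, P i -> (x%:E < ord (F i))%E) -> (x%:E < ord (\sum_(i <- s | P i) F i))%E.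
Proof.
move=> h; apply: (big_ind (fun z => (x%:E < ord z)%E)) => //.
  by rewrite (ord_zero hC) ltey.
by move=> z w hz hw; apply: lt_le_trans (ordD hC z w); rewrite lt_min hz.
Qed.

Variables (e : nat) (he : (0 < e)%N) (varpi : C) (hvarpi : varpi ^+ e = p%:R).
Local Notation K := (padic_adjoin ord varpi).

Lemma varpi_neq0 : varpi != 0.
Proof.
apply/eqP => h; have := p_neq0 hC.
by rewrite -hvarpi h expr0n (negbTE (lt0n_neq0 he)) eqxx.
Qed.

Lemma e_gt0 : 0 < e%:R :> R. Proof. by rewrite ltr0n. Qed.

Lemma v_varpi : v varpi = e%:R^-1.
Proof.
have := vp hC; rewrite -hvarpi (vX hC) ?varpi_neq0 // => h.
by apply: (mulfI (lt0r_neq0 e_gt0)); rewrite h divff // lt0r_neq0 // e_gt0.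
Qed.

(** Exponents are reduced modulo e by varpi^e = p, the powers of p going into the coefficients. *)
Lemma adjoin_coords z : K z ->
  exists c : 'I_e -> C, (forall i, Qp (c i)) /\ z = \sum_i c i * varpi ^+ i.
Proof.
pose S z := exists c : 'I_e -> C, (forall i, Qp (c i)) /\ z = \sum_i c i * varpi ^+ i.
move=> [f [hf ->]]; rewrite horner_coef -/(S _).
apply: (big_ind S).
- exists (fun=> 0); split=> [i|]; first exact: (padic_num0 hp hC).
  by rewrite big1 // => i _; rewrite mul0r.
- move=> _ _ [c [hc ->]] [d [hd ->]]; exists (fun i => c i + d i); split.
    by move=> i; exact: (padic_numD hp hC).
  by rewrite -big_split; apply: eq_bigr => i _; rewrite mulrDl.
move=> i _; exists (fun j : 'I_e => if j == (i %% e)%N :> nat then f`_i * p%:R ^+ (i %/ e) else 0).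
split=> [j|].
  case: ifP => _; last exact: (padic_num0 hp hC).
  by apply: (padic_numM hp hC) => //; apply: (padic_numX hp hC); exact: (padic_num_nat hp hC).
have he' : (i %% e < e)%N by rewrite ltn_mod.
rewrite (bigD1 (Ordinal he')) //= eqxx big1 => [|j jne]; last first.
  by rewrite (_ : (_ == _) = false) ?mul0r //; apply/negbTE; apply: contra jne => /eqP ej;
     apply/eqP/val_inj.
by rewrite addr0 -hvarpi -exprM -mulrA -exprD mulnC -divn_eq.
Qed.

Lemma adjoinB z w : K z -> K w -> K (z - w).
Proof.
move=> [f [hf ->]] [g [hg ->]]; exists (f - g); split; last by rewrite hornerD hornerN.
by move=> i; rewrite coefB; exact: (padic_numB hp hC).
Qed.

Lemma adjoin_sum (I : Type) (s : seq I) (P : pred I) (F : I -> C) :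
  (forall i, P i -> K (F i)) -> K (\sum_(i <- s | P i) F i).
Proof.
move=> h; apply: big_ind => //.
  by exists 0; split=> [i|]; rewrite ?horner0 // coef0; exact: (padic_num0 hp hC).
move=> _ _ [f [hf ->]] [g [hg ->]]; exists (f + g); split; last by rewrite hornerD.
by move=> i; rewrite coefD; exact: (padic_numD hp hC).
Qed.

Lemma adjoinM z w : K z -> K w -> K (z * w).
Proof.
move=> [f [hf ->]] [g [hg ->]]; exists (f * g); split; last by rewrite hornerM.
move=> i; rewrite coefM; apply: (padic_num_sum hp hC) => j _; exact: (padic_numM hp hC).
Qed.

Lemma adjoin_Qp z : Qp z -> K z.
Proof.
move=> h; exists z%:P; rewrite hornerC; split=> // i; rewrite coefC.
by case: eqP => _ //; exact: (padic_num0 hp hC).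
Qed.

Lemma adjoinX z n : K z -> K (z ^+ n).
Proof.
move=> h; elim: n => [|n IH]; first by apply/adjoin_Qp/(padic_num1 hp hC).
by rewrite exprS; exact: adjoinM.
Qed.

(** Valuations on Q_p are integers, so e times the valuation of a term is congruent to i modulo
    e. *)
Lemma v_term (c : C) i : Qp c -> c != 0 ->
  exists n : int, v (c * varpi ^+ i) * e%:R = (n * e%:Z + i%:Z)%:~R.
Proof.
move=> hc nc; have [n vn] := v_Qp hp hC hc nc; exists n.
rewrite (vM hC) ?expf_neq0 ?varpi_neq0 // (vX hC) ?varpi_neq0 // v_varpi vn.
rewrite rmorphD rmorphM /= mulrDl; congr (_ + _).
by rewrite mulfVK // lt0r_neq0 // e_gt0.
Qed.

Lemma v_term_inj (c d : C) (i j : 'I_e) : Qp c -> Qp d -> c != 0 -> d != 0 ->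
  v (c * varpi ^+ i) = v (d * varpi ^+ j) -> i = j.
Proof.
move=> hc hd nc nd; have [n en] := v_term i hc nc; have [m em] := v_term j hd nd.
move=> eq; move: en; rewrite eq em => /intr_inj h; apply/val_inj => /=.
have := ltn_ord i; have := ltn_ord j; move: h.
move=> h lj li.
have h2 : (n - m) * e%:Z = j%:Z - i%:Z by rewrite mulrBl; lia.
have : n - m = 0 by nia.
lia.
Qed.

(* The terms have distinct valuations, being distinct modulo 1. *)
Lemma vge_term (c : 'I_e -> C) x : (forall i, Qp (c i)) ->
  vge x (\sum_i c i * varpi ^+ i) -> forall i, vge x (c i * varpi ^+ i).
Proof.
move=> hc; set z := \sum_i _ => hz i0.
have [->|n0] := eqVneq (c i0) 0; first by rewrite mul0r; exact: (vge0 hC).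
have nt j : c j != 0 -> c j * varpi ^+ j != 0.
  by move=> ?; rewrite mulf_neq0 // expf_neq0 // varpi_neq0.
pose F j := v (c j * varpi ^+ j).
(* A term of least valuation is strictly below all others, hence gives the valuation of the sum. *)
case: (arg_minP (P := fun j => c j != 0) F n0) => i ni min_i.
have lt : ((F i)%:E < ord (z - c i * varpi ^+ i))%E.
  rewrite /z (bigD1 i) //= addrAC subrr add0r; apply: gt_ord_sum => j ji.
  have [->|nj] := eqVneq (c j) 0; first by rewrite mul0r (ord_zero hC) ltey.
  rewrite (ordE hC) ?nt // lte_fin lt_neqAle min_i // andbT.
  by apply: contra ji => /eqP /v_term_inj ->.
have [nz vz] : z != 0 /\ v z = F i.
  have [e0|ne0] := eqVneq (z - c i * varpi ^+ i) 0.
    by move/eqP: e0; rewrite subr_eq0 => /eqP ->; split=> //; exact: nt.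
  apply: (v_near hC (nt _ ni) _ (vgev hC _)).
  by rewrite -lte_fin -(ordE hC ne0).
apply/(vgeE hC); first exact: nt.
by apply: le_trans (min_i _ n0); rewrite -vz; apply/(vgeE hC).
Qed.

(** Positivity passes from the sum to its terms, and a positive element of (1/e)Z is at least
    1/e. *)
Lemma adjoin_pos z : K z -> (0 < ord z)%E -> vge e%:R^-1 z.
Proof.
move=> /adjoin_coords [c [hc ->]] /(pos_vge hC)[x x0 hx].
have ht := vge_term hc hx; apply: (vge_sum hC) => i _.
have [->|ni] := eqVneq (c i) 0; first by rewrite mul0r; exact: (vge0 hC).
have nt : c i * varpi ^+ i != 0 by rewrite mulf_neq0 // expf_neq0 // varpi_neq0.
apply/(vgeE hC) => //; have /(vgeE hC) := ht i => /(_ nt) le.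
have [n en] := v_term i (hc i) ni.
have : 0 < v (c i * varpi ^+ i) * e%:R by rewrite mulr_gt0 ?e_gt0 //; exact: lt_le_trans le.
rewrite -[e%:R^-1]mul1r ler_pdivrMr ?e_gt0 // en ltr0z => h.
by rewrite ler1z; lia.
Qed.

(** Total ramification: a term with 0 < i < e has valuation outside Z, hence positive once
    nonnegative, and only the term i = 0 is left in the residue field. *)
Lemma adjoin_near_Zp z : K z -> vge 0 z -> near_Zp z.
Proof.
move=> /adjoin_coords [c [hc ->]] hx.
have ht := vge_term hc hx; apply: near_Zp_sum => i _.
have [i0|i0] := eqVneq (i : nat) 0%N.
  by apply: near_ZpZp; move: (ht i); rewrite i0 mulr1 => h; split.
have [->|ni] := eqVneq (c i) 0; first by rewrite mul0r; apply/near_ZpZp/(padic_int0 hp hC).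
exists 0; first exact: (padic_int0 hp hC).
have nt : c i * varpi ^+ i != 0 by rewrite mulf_neq0 // expf_neq0 // varpi_neq0.
rewrite subr0 (ordE hC) // lte_fin lt_neqAle; apply/andP; split; last exact/(vgeE hC).
apply/eqP => v0; have [n] := v_term i (hc i) ni; rewrite -v0 mul0r.
move/esym/eqP; rewrite intr_eq0 => /eqP h.
have := ltn_ord i; move: i0 h; move: (i : nat) => j /negP j0 h je.
have [n0|n0] := lerP 0 n; first by apply: j0; apply/eqP; nia.
by nia.
Qed.

Lemma adjoin_complete (u : nat -> C) : (forall n, K (u n)) ->
  (forall M : nat, exists n0, forall m n, (n0 <= m)%N -> (n0 <= n)%N -> vge M%:R (u m - u n)) ->
  exists z, ord_cvg ord u z.
Proof.
move=> hK hu.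
have [c /all_and2 [hc uE]] := choice (fun n => adjoin_coords (hK n)).
have hdiff m n x : vge x (u m - u n) -> forall i, vge x ((c m i - c n i) * varpi ^+ i).
  rewrite !uE -sumrB; under eq_bigr do rewrite -mulrBl.
  by move=> h; apply: (@vge_term (fun i => c m i - c n i)) => // j; exact: (padic_numB hp hC).
have vpi i : vge (i%:R / e%:R) (varpi ^+ i).
  by rewrite -v_varpi -(vX hC) ?varpi_neq0 //; exact: (vgev hC).
have /choice [L hL] : forall i : 'I_e, exists z, ord_cvg ord (fun n => c n i) z.
  move=> i; case: hC => _ /(_ (fun n => c n i)) hcompl _; apply: hcompl => // M.
  (* One more digit is asked for, because dividing by varpi^i costs i/e < 1. *)
  have [n0 hn0] := hu M.+1; exists n0 => m n hm hn; have := hdiff _ _ _ (hn0 m n hm hn) i.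
  have [->|ne0] := eqVneq (c m i - c n i) 0; first by move=> _; rewrite (ord_zero hC) leey.
  have nvp : varpi ^+ i != 0 by rewrite expf_neq0 // varpi_neq0.
  move/(vgeE hC) => /(_ (mulf_neq0 ne0 nvp)).
  rewrite (vM hC) // (vX hC) ?varpi_neq0 // v_varpi => h.
  apply/(vgeE hC) => //.
  have : i%:R / e%:R <= 1 :> R by rewrite ler_pdivrMr ?e_gt0 // mul1r ler_nat ltnW.
  move: h; rewrite -natr1 => h h2; lra.
exists (\sum_i L i * varpi ^+ i) => M.
have /choice [n0 hn0] : forall i, exists n0, forall n, (n0 <= n)%N -> vge M%:R (c n i - L i).
  by move=> i; exact: hL.
exists (\max_i n0 i) => n hn; rewrite uE -sumrB.
apply: (vge_sum hC) => i _; rewrite -mulrBl; apply: (vgeMr hC).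
  by apply: hn0; apply: leq_trans hn; exact: leq_bigmax.
apply: (vge_mono _ (vpi i)); rewrite divr_ge0 ?ler0n //.
Qed.

End Ramified.

(** * Points of etale algebras over Z_p *)

Section EtalePoint.
Variables (R : realType) (p : nat) (C : closedFieldType) (ord : C -> \bar R).
Hypotheses (hp : prime p) (hC : padic_closure p ord).

Local Notation Qp := (padic_num ord).
Local Notation Zp := (padic_int ord).
Local Notation vge := (vge ord).

Variables (q : nat) (m : 'I_q -> 'I_q -> 'I_q -> C) (t : 'I_q -> C).
Hypothesis m_Zp : forall i j n, Zp (m i j n).
Hypothesis t_mul : forall i j, t i * t j = \sum_n m i j n * t n.

(** For t_j of least valuation v among the nonzero values, t_j^2 is an integral combination of the
    t_n, so 2v >= v. *)
Lemma structure_point_integral i : vge 0 (t i).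
Proof.
have [->|nz] := eqVneq (t i) 0; first exact: (vge0 hC).
case: (arg_minP (P := fun j => t j != 0) (fun j => padic_val ord (t j)) nz) => j nj min_j.
suff : vge 0 (t j).
  by move=> /(vgeE hC _ nj) h; apply/(vgeE hC) => //; exact: le_trans h (min_j _ nz).
have : vge (padic_val ord (t j)) (t j * t j).
  rewrite t_mul; apply: (vge_sum hC) => n _; apply: (vgeMl hC); first by case: (m_Zp j j n).
  have [->|nn] := eqVneq (t n) 0; first exact: (vge0 hC).
  by apply/(vgeE hC) => //; exact: min_j.
move=> /(vgeE hC _ (mulf_neq0 nj nj)); rewrite (vM hC) // => h.
by apply/(vgeE hC) => //; lra.
Qed.

Hypothesis m_assoc : forall i j l s,
  \sum_n m i j n * m n l s = \sum_n m j l n * m i n s.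

(** [tau n] is the trace of multiplication by the n-th basis element, and [G] the Gram matrix of the
    trace form. *)
Let tau n := \sum_j m n j j.
Let G := \matrix_(i, j) \sum_n m i j n * tau n.
Hypothesis G_unit : padic_unit ord (\det G).
Hypothesis t_neq0 : exists l, t l != 0.
Hypothesis t_near : forall i, near_Zp ord (t i).

Let H := invmx G.

Lemma trace_form_unitmx : G \in unitmx.
Proof.
rewrite unitmxE unitfE; apply/eqP => d0; case: G_unit; rewrite d0 (ord_zero hC).
by [].
Qed.

(** Cramer's rule: the cofactors lie in Z_p and the determinant is a unit. *)
Lemma trace_form_inv_Zp i j : Zp (H i j).
Proof.
have G_Zp k l : Zp (G k l).
  rewrite mxE; apply: (padic_int_sum hp hC) => n _; apply: (padic_intM hp hC) => //.
  by apply: (padic_int_sum hp hC) => s _.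
have det_Zp n (A : 'M[C]_n) : (forall k l, Zp (A k l)) -> Zp (\det A).
  move=> hA; apply: (padic_int_sum hp hC) => s _; apply: (padic_intM hp hC).
    by apply: (padic_intX hp hC); apply: (padic_intN hp hC); exact: (padic_int1 hp hC).
  by apply: (padic_int_prod hp hC) => k _.
have [d_Qp d0] := G_unit.
have nd : \det G != 0 by have := trace_form_unitmx; rewrite unitmxE unitfE.
rewrite /H /invmx trace_form_unitmx !mxE; apply: (padic_intM hp hC).
  split; first exact: (padic_numV hp hC).
  by apply/(vgeE hC); rewrite ?invr_neq0 // (vV hC) // /padic_val d0 oppr0.
rewrite /cofactor; apply: (padic_intM hp hC).
  by apply: (padic_intX hp hC); apply: (padic_intN hp hC); exact: (padic_int1 hp hC).
by apply: det_Zp => k l; rewrite !mxE; have := G_Zp (lift j k) (lift i l); rewrite mxE.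
Qed.

(* The coordinates of the idempotent that cuts out the point t. *)
Let w i := \sum_l t l * H l i.

(** This is Tr(w e_l) = t_l: evaluation at the point is the trace pairing with w. *)
Lemma idempotent_dual l : \sum_i w i * G i l = t l.
Proof.
have : (\row_i t i *m H *m G) 0 l = t l by rewrite mulmxKV ?trace_form_unitmx // mxE.
rewrite mxE => e; rewrite -[RHS]e; apply: eq_bigr => i _; congr (_ * _).
by rewrite mxE; apply: eq_bigr => j _; rewrite mxE.
Qed.

(** In the algebra this reads w e_j = t_j w. Both sides have the same trace pairing with every e_l:
    by associativity Tr(w e_j e_l) is the value of e_j e_l, which is t_j t_l. *)
Lemma idempotent_mul j n : \sum_i w i * m i j n = t j * w n.
Proof.
pose T n := \sum_i w i * m i j n.
have key l : \sum_n T n * G n l = t j * t l.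
  transitivity (\sum_i w i * \sum_n m i j n * G n l).
    under eq_bigr do rewrite /T mulr_suml.
    rewrite exchange_big; apply: eq_bigr => i _; rewrite mulr_sumr.
    by apply: eq_bigr => k _; rewrite mulrA.
  transitivity (\sum_i w i * \sum_n m j l n * G i n).
    apply: eq_bigr => i _; congr (_ * _).
    transitivity (\sum_s (\sum_n m i j n * m n l s) * tau s).
      under [RHS]eq_bigr do rewrite mulr_suml.
      rewrite exchange_big; apply: eq_bigr => k _; rewrite mxE mulr_sumr.
      by apply: eq_bigr => s _; rewrite mulrA.
    under eq_bigr do rewrite m_assoc mulr_suml.
    rewrite exchange_big; apply: eq_bigr => k _; rewrite mxE mulr_sumr.
    by apply: eq_bigr => s _; rewrite mulrA.
  rewrite t_mul; under eq_bigr do rewrite mulr_sumr.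
  rewrite exchange_big; apply: eq_bigr => k _; rewrite -idempotent_dual mulr_sumr.
  by apply: eq_bigr => i _; ring.
have : \row_n T n *m G = t j *: \row_n w n *m G.
  apply/rowP => l; rewrite !mxE.
  under eq_bigr do rewrite mxE.
  rewrite key; under [RHS]eq_bigr do rewrite !mxE -mulrA.
  by rewrite -mulr_sumr; congr (_ * _); rewrite -[LHS]idempotent_dual; apply: eq_bigr => i _; rewrite mxE.
move/(canRL (mulmxK trace_form_unitmx)); rewrite mulmxK ?trace_form_unitmx //.
by move=> /rowP/(_ n); rewrite !mxE.
Qed.

(** As w e_j = t_j w, the trace of w is sum_j t_j w_j, which is the value of w at the point.
    Moreover t_l = Tr(w e_l) = t_l Tr(w), and some t_l is nonzero. *)
Lemma idempotent_value : \sum_i w i * t i = 1.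
Proof.
have e1 : \sum_j \sum_i w i * m i j j = \sum_j t j * w j.
  by apply: eq_bigr => j _; rewrite idempotent_mul.
rewrite exchange_big in e1.
have e2 : \sum_i w i * tau i = \sum_i w i * t i.
  transitivity (\sum_j t j * w j); last by apply: eq_bigr => i _; rewrite mulrC.
  by rewrite -e1; apply: eq_bigr => i _; rewrite -mulr_sumr.
have [l nl] := t_neq0; apply: (mulfI nl); rewrite mulr1 -{2}idempotent_dual.
under [RHS]eq_bigr do rewrite mxE mulr_sumr.
rewrite exchange_big -e2 mulr_sumr; apply: eq_bigr => n _.
by rewrite mulrA -idempotent_mul mulr_suml; apply: eq_bigr => i _; rewrite mulrA.
Qed.

(* Newton step: contracting the linearised equations with the idempotent w
   inverts them. *)
Lemma structure_point_newton (a : 'I_q -> C) (d : R) : 0 <= d ->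
  (forall i, Zp (a i)) -> (forall i, vge d (t i - a i)) ->
  exists a', (forall i, Zp (a' i)) /\ (forall i, vge (d + d) (t i - a' i)).
Proof.
move=> d0 ha hd.
(* The coordinates of w are not yet known to lie in Z_p. Those of [b], formed from [a] in the same
   way, do, and they differ from them by order d. *)
pose b i := \sum_l a l * H l i.
pose F i j := a i * a j - \sum_n m i j n * a n.
have F_Zp i j : Zp (F i j).
  apply: (padic_intB hp hC); first exact: (padic_intM hp hC).
  by apply: (padic_int_sum hp hC) => n _; exact: (padic_intM hp hC).
have b_Zp i : Zp (b i).
  by apply: (padic_int_sum hp hC) => l _; apply: (padic_intM hp hC) => //; exact: trace_form_inv_Zp.
exists (fun j => a j - \sum_i b i * F i j); split=> j.
  apply: (padic_intB hp hC) => //; apply: (padic_int_sum hp hC) => i _.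
  exact: (padic_intM hp hC).
pose h i := t i - a i.
have aE i : a i = t i - h i by rewrite /h subKr.
have t0 i : vge 0 (t i) by exact: (near_Zp_int hC (t_near i)).
have w0 i : vge 0 (w i).
  apply: (vge_sum hC) => l _; apply: (vgeMl hC) => //.
  by case: (trace_form_inv_Zp l i).
have FE i : F i j = - (t i * h j + h i * t j - \sum_n m i j n * h n) + h i * h j.
  have -> : F i j = (t i - h i) * (t j - h j) - \sum_n m i j n * (t n - h n).
    by rewrite /F !aE; congr (_ - _); apply: eq_bigr => n _; rewrite aE.
  under [X in _ - X = _]eq_bigr do rewrite mulrBr.
  by rewrite sumrB -t_mul; ring.
(* By [idempotent_mul] the sum over m contracts to the same as h_i t_j and cancels it;
   [idempotent_value] turns the first term into h_j. *)
have hm : \sum_i w i * (t i * h j + h i * t j - \sum_n m i j n * h n) = h j.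
  under eq_bigr do rewrite mulrBr mulrDr.
  rewrite sumrB big_split /=.
  have -> : \sum_i w i * (t i * h j) = h j.
    by under eq_bigr do rewrite mulrA; rewrite -mulr_suml idempotent_value mul1r.
  have -> : \sum_i w i * (\sum_n m i j n * h n) = \sum_i w i * (h i * t j).
    under eq_bigr do rewrite mulr_sumr.
    rewrite exchange_big; apply: eq_bigr => n _.
    rewrite [RHS]mulrA [RHS]mulrC mulrA -idempotent_mul mulr_suml.
    by apply: eq_bigr => i _; rewrite mulrA.
  by rewrite addrK.
have hF i : vge d (F i j).
  rewrite FE; apply: (vgeD hC); last exact: (vgeMl hC (vge_mono d0 (hd i)) (hd j)).
  apply: (vgeN hC); apply: (vgeB hC); first by apply: (vgeD hC); [exact: (vgeMl hC (t0 i) (hd j))|exact: (vgeMr hC (hd i) (t0 j))].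
  by apply: (vge_sum hC) => n _; apply: (vgeMl hC _ (hd n)); case: (m_Zp i j n).
(* What remains after the linear part cancels is a sum of products of two factors of order d: h_i
   h_j, and (w_i - b_i) F_ij. *)
have -> : t j - (a j - \sum_i b i * F i j) =
    \sum_i w i * h i * h j - \sum_i (w i - b i) * F i j.
  have -> : t j - (a j - \sum_i b i * F i j) = h j + \sum_i b i * F i j by rewrite /h; ring.
  rewrite -[X in X + _ = _]hm -big_split -sumrB /=; apply: eq_bigr => i _.
  by rewrite [in LHS]FE [in RHS]FE; ring.
apply: (vgeB hC); apply: (vge_sum hC) => i _.
  exact: (vgeM hC (vgeMl hC (w0 i) (hd i)) (hd j)).
apply: (vgeM hC) => //; rewrite /w /b -sumrB; apply: (vge_sum hC) => l _.
by rewrite -mulrBl; apply: (vgeMr hC (hd l)); case: (trace_form_inv_Zp l i).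
Qed.

Lemma structure_point_padic i : Qp (t i).
Proof.
have /choice [a ha] : forall i, exists a, Zp a /\ (0 < ord (t i - a))%E.
  by move=> j; have [a] := t_near j; exists a.
have /choice [x hx] : forall i, exists x, 0 < x /\ vge x (t i - a i).
  by move=> j; have [_ /(pos_vge hC)[x]] := ha j; exists x.
have [d d0 hd] : exists2 d, 0 < d & forall i, vge d (t i - a i).
  exists (\big[Num.min/1]_i x i).
    by apply: (big_ind (fun y => 0 < y)) => // [y z y0 z0|j _];
      [rewrite lt_min y0 z0 | case: (hx j)].
  by move=> j; have [_ hj] := hx j; apply: (vge_mono _ hj); exact: bigmin_le_cond.
(* The Newton step doubles the precision; a gain of d per step is enough for convergence. *)
have iter n : exists a', (forall i, Zp (a' i)) /\ (forall i, vge (n.+1%:R * d) (t i - a' i)).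
  elim: n => [|n [a' [ha' IH]]]; first by exists a; rewrite mul1r; split=> // j; case: (ha j).
  have [|a'' [ha'' h]] := structure_point_newton _ ha' IH.
    by rewrite mulr_ge0 // ltW.
  exists a''; split=> // j; apply: (vge_mono _ (h j)).
  by rewrite -mulrDl ler_pM2r // -natrD ler_nat; lia.
apply: (padic_num_intro hC) => M.
have [n hn] := nat_real (M%:R / d).
have [a' [ha' h]] := iter n; exists (a' i); first by case: (ha' i).
apply: (vge_mono _ (h i)); rewrite -ler_pdivrMr //; apply: le_trans hn _.
by rewrite ler_nat.
Qed.

End EtalePoint.

(** * Termwise error bounds *)

Section TinyIntegral.
Variables (R : realType) (p : nat) (C : closedFieldType) (ord : C -> \bar R).
Hypotheses (hp : prime p) (hC : padic_closure p ord).

Local Notation Qp := (padic_num ord).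
Local Notation Zp := (padic_int ord).
Local Notation vge := (vge ord).
Local Notation v := (padic_val ord).
Local Notation K := (padic_adjoin ord).

Lemma ord_sum_ge (B : \bar R) (I : Type) (s : seq I) (P : pred I) (F : I -> C) :
  (forall i, P i -> (B <= ord (F i))%E) -> (B <= ord (\sum_(i <- s | P i) F i))%E.
Proof.
move=> h; apply: (big_ind (fun z => (B <= ord z)%E)) => //.
  by rewrite (ord_zero hC) leey.
by move=> z w hz hw; apply: le_trans (ordD hC z w); rewrite le_min hz.
Qed.

Lemma ordB_ge (B : \bar R) z w : (B <= ord z)%E -> (B <= ord w)%E -> (B <= ord (z - w))%E.
Proof.
move=> hz hw; have hw' : (B <= ord (- w))%E.
  rewrite -mulN1r (ordM hC); suff -> : ord (-1) = 0%E by rewrite add0e.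
  have n1 : - 1 != 0 :> C by rewrite oppr_eq0 oner_eq0.
  apply/eqP; rewrite eq_le -(ord_one hC); apply/andP; split; last first.
    by rewrite (ord_one hC); exact: (vgeN hC (vge1 hC)).
  have /(vgeE hC _ n1) h : vge (v (-1)) (-1) := vgev hC _.
  have := vgeN hC (vgev hC (-1)); rewrite opprK => /(vgeE hC _ (oner_neq0 _)).
  by rewrite -lee_fin -!(ordE hC) ?oner_neq0.
by apply: le_trans (ordD hC z (- w)); rewrite le_min hz.
Qed.

(** The power of p with exponent ord(n+1) divides n+1, hence is at most n+1. *)
Lemma vge_natV n : vge (- (trunc_log p n.+1)%:R) (n.+1)%:R^-1.
Proof.
have [nz vn] := v_nat hp hC (ltn0Sn n).
apply/(vgeE hC); first by rewrite invr_neq0.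
rewrite (vV hC) // vn lerN2 ler_nat; apply: trunc_log_max; first exact: prime_gt1.
by apply: dvdn_leq => //; exact: pfactor_dvdnn.
Qed.

(** A crude bound, enough to see that the logarithm grows more slowly than i/e. With L the logarithm
    and h = floor(L/2), L <= 2 * 2^h, so L^2 <= 4 * 2^L <= 4n. *)
Lemma trunc_log_sqr n : (0 < n -> trunc_log p n ^ 2 <= 4 * n)%N.
Proof.
move=> n0; apply: (@leq_trans (4 * 2 ^ trunc_log p n)).
  have := ltn_expl (trunc_log p n)./2 (isT : 1 < 2)%N.
  have := odd_double_half (trunc_log p n).
  move: (trunc_log p n) => L; set h := L./2 => eL lt.
  have -> : (2 ^ L = 2 ^ (odd L) * (2 ^ h) ^ 2)%N by rewrite -expnM -expnD muln2 eL.
  have : (L <= (2 ^ h) * 2)%N by rewrite -eL; case: (odd L) => /=; lia.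
  move: (2 ^ h)%N => x; case: (odd L) => /=; nia.
rewrite leq_mul2l /=; apply: leq_trans (trunc_logP (prime_gt1 hp) n0).
by case: trunc_log => // L; rewrite leq_exp2r // prime_gt1.
Qed.

(** The contribution of one endpoint to a term of [partial_integral], so that the errors at P and at
    Q can be bounded separately. *)
Definition integrated_term (a : int -> C) (i : int) (t : C) : C :=
  if i == -1 then 0 else a i / (i + 1)%:~R * t ^ (i + 1).

Lemma partial_integralE a k tP tQ n : partial_integral a k tP tQ n =
  \sum_(j < n) (integrated_term a (j%:Z - k%:Z) tQ - integrated_term a (j%:Z - k%:Z) tP).
Proof.
apply: eq_bigr => j _; rewrite /integrated_term; case: eqP => _; first by rewrite subrr.
by rewrite mulrBr.
Qed.

Lemma integrated_term_nat a (i : nat) t :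
  integrated_term a i%:Z t = a i%:Z / i.+1%:R * t ^+ i.+1.
Proof. by rewrite /integrated_term /= -PoszD addn1. Qed.

Lemma vge_exprV t n : t != 0 -> vge (- n%:R * v t) (t^-1 ^+ n).
Proof.
move=> nt; apply/(vgeE hC); first by rewrite expf_neq0 // invr_neq0.
by rewrite (vX hC) ?invr_neq0 // (vV hC) // mulrN mulNr.
Qed.

Lemma integrated_term_neg a (m : nat) t :
  integrated_term a (- m.+2%:Z) t = - (a (- m.+2%:Z) / m.+1%:R * t^-1 ^+ m.+1).
Proof.
have -> : integrated_term a (- m.+2%:Z) t =
    a (- m.+2%:Z) / (- m.+1%:Z)%:~R * t ^ (- m.+1%:Z).
  have e1 : - m.+2%:Z + 1 = - m.+1%:Z by lia.
  by rewrite /integrated_term e1 (_ : (_ == _) = false) //; apply/eqP; lia.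
by rewrite mulrNz invrN mulrN mulNr exprVn.
Qed.

(** This is where the factor k of nu3 comes from. The coefficient error is multiplied by a power of
    1/t' of exponent m+1 only. The error of the argument costs more: 1/t' - 1/t = -(t' - t)/(t t')
    loses 2 v(t), and the cofactor of degree m in 1/t, 1/t' loses m v(t), which makes m+2, the order
    of the pole. Integration divides by m+1, whence the logarithm of k-1. *)
Lemma vge_pole_term_error (a at_ : int -> C) (m : nat) t t' (N : R) :
  vge 0 (a (- m.+2%:Z)) -> vge N (at_ (- m.+2%:Z) - a (- m.+2%:Z)) ->
  t != 0 -> t' != 0 -> v t' = v t -> 0 <= v t -> vge N (t' - t) ->
  vge (N - m.+2%:R * v t - (trunc_log p m.+1)%:R)
    (integrated_term at_ (- m.+2%:Z) t' - integrated_term a (- m.+2%:Z) t).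
Proof.
move=> ha hat nt nt' vtt' vt0 htt; rewrite !integrated_term_neg -opprD; apply: (vgeN hC).
move: (at_ _) (a _) ha hat => b' b hb hb'.
have -> : b' / m.+1%:R * t'^-1 ^+ m.+1 + - (b / m.+1%:R * t^-1 ^+ m.+1) =
  ((b' - b) * t'^-1 ^+ m.+1 + b * (t'^-1 ^+ m.+1 - t^-1 ^+ m.+1)) / m.+1%:R by ring.
apply: (vgeM hC); last exact: vge_natV.
apply: (vgeD hC).
  apply: (vgeM hC hb'); apply: (vge_mono _ (vge_exprV m.+1 nt')).
  by rewrite vtt' mulNr lerN2 ler_wpM2r // ler_nat.
apply: (vgeMl hC) => //; rewrite subrXX.
have -> : t'^-1 - t^-1 = - ((t' - t) * (t'^-1 * t^-1)).
  by field; apply/andP.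
rewrite mulNr -mulrA; apply: (vgeN hC); apply: (vgeM hC htt).
have -> : - (m.+2%:R * v t) = - v t + - v t + - m%:R * v t by rewrite -!natr1; ring.
apply: (vgeM hC).
  apply: (vgeM hC).
    by rewrite -vtt' -(vV hC) //; exact: (vgev hC).
  by rewrite -(vV hC) //; exact: (vgev hC).
apply: (vge_sum hC) => j _.
apply: (vge_mono _ (vgeM hC (vge_exprV _ nt') (vge_exprV j nt))).
rewrite vtt' -mulrDl -opprD -natrD /= subnK //.
by have := ltn_ord j; rewrite ltnS.
Qed.

Variables (e : nat) (he : (0 < e)%N).

Lemma slope_unbounded (M : nat) : exists n0, forall n, (n0 <= n)%N ->
  M%:R <= n.+1%:R / e%:R - (trunc_log p n.+1)%:R :> R.
Proof.
(* Write L for the logarithm of n+1. The first summand and L^2 <= 4(n+1) force 2eL <= n+1; the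
   second gives 2eM <= n. Together e(M + L) <= n+1. *)
exists (16 * e ^ 2 + 2 * e * M)%N => n hn.
have h := trunc_log_sqr (ltn0Sn n).
have hL : (2 * e * trunc_log p n.+1 <= n.+1)%N.
  rewrite leqNgt; apply/negP; move: (trunc_log p n.+1) h => L; nia.
rewrite lerBrDr ler_pdivlMr ?ltr0n // -natrD -natrM ler_nat.
by move: (trunc_log p n.+1) hL => L; nia.
Qed.

Lemma vge_expr t n : vge e%:R^-1 t -> vge (n%:R / e%:R) (t ^+ n).
Proof.
move=> ht; elim: n => [|n IH]; first by rewrite mul0r; exact: (vge1 hC).
by rewrite exprS mulrS mulrDl mul1r; exact: (vgeM hC).
Qed.

Lemma vge_integrated_term a (i : nat) t : vge 0 (a i%:Z) -> vge e%:R^-1 t ->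
  vge (i.+1%:R / e%:R - (trunc_log p i.+1)%:R) (integrated_term a i%:Z t).
Proof.
move=> ha ht; rewrite integrated_term_nat.
rewrite addrC; apply: (vgeM hC); last exact: vge_expr.
by apply: (vgeMl hC) => //; exact: vge_natV.
Qed.

(** Factoring t' - t out of t'^(i+1) - t^(i+1) leaves forms of degree i, hence i/e and not (i+1)/e
    as in the tail. *)
Lemma vge_term_error (a at_ : int -> C) (i : nat) t t' (N : R) :
  vge 0 (a i%:Z) -> vge N (at_ i%:Z - a i%:Z) ->
  vge e%:R^-1 t -> vge e%:R^-1 t' -> vge N (t' - t) ->
  vge (N + (i%:R / e%:R - (trunc_log p i.+1)%:R))
    (integrated_term at_ i%:Z t' - integrated_term a i%:Z t).
Proof.
move=> ha hat ht ht' htt; rewrite !integrated_term_nat.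
have -> : at_ i%:Z / i.+1%:R * t' ^+ i.+1 - a i%:Z / i.+1%:R * t ^+ i.+1 =
  ((at_ i%:Z - a i%:Z) * t' ^+ i.+1 + a i%:Z * (t' ^+ i.+1 - t ^+ i.+1)) / i.+1%:R.
  by ring.
rewrite addrA; apply: (vgeM hC); last exact: vge_natV.
apply: (vgeD hC).
  apply: (vgeM hC) => //; apply: (vge_mono _ (vge_expr i.+1 ht')).
  by rewrite ler_pM2r ?invr_gt0 ?ltr0n // ler_nat.
apply: (vgeMl hC) => //; rewrite subrXX; apply: (vgeM hC) => //.
apply: (vge_sum hC) => j _.
apply: (vge_mono _ (vgeM hC (vge_expr _ ht') (vge_expr j ht))).
rewrite -mulrDl ler_pM2r ?invr_gt0 ?ltr0n // -natrD ler_nat /= subnK //.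
by have := ltn_ord j; rewrite ltnS.
Qed.

End TinyIntegral.

(** * Assembling the three bounds *)

Section TinyIntegralPrecision.
Variables (R : realType) (p : nat) (C : closedFieldType) (ord : C -> \bar R).
Hypotheses (hp : prime p) (hC : padic_closure p ord).

Local Notation Qp := (padic_num ord).
Local Notation Zp := (padic_int ord).
Local Notation vge := (vge ord).
Local Notation v := (padic_val ord).

Variables (e : nat) (he : (0 < e)%N) (varpi : C) (hvarpi : varpi ^+ e = p%:R).
Local Notation K := (padic_adjoin ord varpi).

Lemma ereal_inf_slope (S : set nat) i : S i ->
  (ereal_inf [set slope R p e i | i in S] <= slope R p e i)%E.
Proof. by move=> Si; apply: ereal_inf_lbound; exists i. Qed.

Section FixedData.
Variables (k : nat) (a : int -> C) (tP tQ : C).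
Hypothesis ha : forall i : int, - k%:Z <= i -> Zp (a i).
Hypotheses (KP : K tP) (KQ : K tQ) (pP : (0 < ord tP)%E) (pQ : (0 < ord tQ)%E).

Let term (i : int) := integrated_term a i tQ - integrated_term a i tP.

Let vP : vge e%:R^-1 tP. Proof. exact: adjoin_pos hvarpi _ KP pP. Qed.
Let vQ : vge e%:R^-1 tQ. Proof. exact: adjoin_pos hvarpi _ KQ pQ. Qed.

Let ha_nat (i : nat) : Zp (a i%:Z). Proof. by apply: ha; lia. Qed.

Lemma vge_tail_term (i : nat) :
  vge (i.+1%:R / e%:R - (trunc_log p i.+1)%:R) (term i%:Z).
Proof.
by apply: (vgeB hC); apply: (vge_integrated_term hp hC) => //; case: (ha_nat i).
Qed.

Lemma partial_integral_diff n n' : (n <= n')%N ->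
  partial_integral a k tP tQ (k + n') - partial_integral a k tP tQ (k + n) =
  \sum_(n <= i < n') term i%:Z.
Proof.
move=> nn'; rewrite !partial_integralE !big_split_ord /=.
have e1 m : \sum_(i < m) (integrated_term a ((k + i)%:Z - k%:Z) tQ -
    integrated_term a ((k + i)%:Z - k%:Z) tP) = \sum_(0 <= i < m) term i%:Z.
  by rewrite big_mkord; apply: eq_bigr => i _; rewrite /term PoszD addrAC subrr add0r.
rewrite opprD addrACA subrr add0r !e1 (big_cat_nat (leq0n n) nn') /=.
by rewrite addrAC subrr add0r.
Qed.

(** The first k summands are a fixed quantity and are subtracted. The other partial sums are
    polynomial in tP and tQ over Q_p, so they stay in [K] without inverting a parameter, and
    [adjoin_complete] applies. *)
Lemma tiny_integral_exists : exists I, tiny_integral ord a k tP tQ I.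
Proof.
pose u n := partial_integral a k tP tQ (k + n) - partial_integral a k tP tQ (k + 0).
have uE n n' : (n <= n')%N -> u n' - u n = \sum_(n <= i < n') term i%:Z.
  by move=> h; rewrite -partial_integral_diff // /u opprB addrA subrK.
have Kterm i : K (term i%:Z).
  have Kt t : K t -> K (integrated_term a i%:Z t).
    move=> Kt; rewrite integrated_term_nat; apply: (adjoinM hp hC); last exact: (adjoinX hp hC).
    apply: (adjoinM hp hC); apply: (adjoin_Qp hp hC); first by case: (ha_nat i).
    by apply: (padic_numV hp hC); exact: (padic_num_nat hp hC).
  by apply: (adjoinB hp hC); exact: Kt.
have [|M|I hI] := @adjoin_complete _ _ _ _ hp hC _ he _ hvarpi u.
- by move=> n; rewrite /u partial_integral_diff //; apply: (adjoin_sum hp hC).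
- have [n0 hn0] := @slope_unbounded R p hp e he M.
  have H m n : (n0 <= m)%N -> (m <= n)%N -> vge M%:R (u n - u m).
    move=> hm hmn; rewrite uE // big_nat_cond; apply: (vge_sum hC) => i /andP[/andP[hi _] _].
    exact: (vge_mono (hn0 _ (leq_trans hm hi)) (vge_tail_term i)).
  exists n0 => m n hm hn; have [mn|/ltnW nm] := leqP m n; last exact: H.
  by rewrite -opprB; apply: (vgeN hC); exact: H.
exists (I + partial_integral a k tP tQ (k + 0)) => M.
have [n0 hn0] := hI M; exists (k + n0)%N => n hn.
have -> : n = (k + (n - k))%N by lia.
have := hn0 (n - k)%N; rewrite /u opprD addrA [_ - _ - I]addrAC; apply; lia.
Qed.

Lemma nu1_bound l I : tiny_integral ord a k tP tQ I ->
  (nu1 R p e l <= ord (partial_integral a k tP tQ (k + l) - I))%E.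
Proof.
move=> hI.
have nu1_le i : (l <= i)%N ->
    (nu1 R p e l <= (i.+1%:R / e%:R - (trunc_log p i.+1)%:R)%:E)%E.
  move=> li; apply: (@le_trans _ _ ((e%:R^-1)%:E + slope R p e i)%E).
    by apply: leeD2l; exact: ereal_inf_slope.
  by rewrite /slope -EFinD lee_fin addrA [_^-1 + _]addrC -[in leRHS]natr1 mulrDl mul1r.
(* I is only accessible through a later partial sum. M exceeds the bound for the term l, hence nu1,
   so replacing I by that partial sum is harmless. *)
have [M hM] := nat_real (l.+1%:R / e%:R - (trunc_log p l.+1)%:R : R).
have [n0 hn0] := hI M.
set n := (n0 + l)%N.
have -> : partial_integral a k tP tQ (k + l) - I =
   (partial_integral a k tP tQ (k + n) - I) -
   (partial_integral a k tP tQ (k + n) - partial_integral a k tP tQ (k + l)) by ring.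
apply: (ordB_ge hC).
  apply: le_trans (nu1_le l (leqnn l)) _; apply: (@le_trans _ _ M%:R%:E).
    by rewrite lee_fin.
  by apply: hn0; rewrite /n; lia.
rewrite partial_integral_diff; last by rewrite /n; lia.
rewrite big_nat_cond; apply: (ord_sum_ge hC) => i /andP[/andP[hi _] _].
exact: le_trans (nu1_le i hi) (vge_tail_term i).
Qed.

Variables (N : nat) (hN : (0 < N)%N) (tP' tQ' : C) (at_ : int -> C) (l : nat).
Hypotheses (hP : vge N%:R (tP' - tP)) (hQ : vge N%:R (tQ' - tQ)).
Hypothesis hat : forall i : int, - k%:Z <= i < l%:Z -> accurate ord N (at_ i) (a i).

Let term' (i : int) := integrated_term at_ i tQ' - integrated_term at_ i tP'.

(** Since N >= 1 >= 1/e, computed parameters have valuation at least 1/e, like the true ones. *)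
Let vt' t t' : vge e%:R^-1 t -> vge N%:R (t' - t) -> vge e%:R^-1 t'.
Proof.
move=> h h'; rewrite -[t'](subrK t); apply: (vgeD hC) => //; apply: (vge_mono _ h').
have N1 : 1 <= N%:R :> R by rewrite ler1n.
by apply: le_trans N1; rewrite invf_le1 ?ltr0n // ler1n.
Qed.

Lemma nu2_bound (i : nat) : (i < l)%N -> (nu2 R p e N l <= ord (term' i%:Z - term i%:Z))%E.
Proof.
move=> il; apply: (@le_trans _ _ (N%:R%:E + slope R p e i)%E).
  by apply: leeD2l; exact: (@ereal_inf_slope [set i | (i < l)%N]).
rewrite /slope -EFinD /term' /term opprD addrACA -opprD.
have hi : vge N%:R (at_ i%:Z - a i%:Z) by apply: hat; lia.
have [_ h0] := ha_nat i.
apply: (vgeB hC); apply: (vge_term_error hp hC) => //; [exact: vt' vQ hQ | exact: vt' vP hP].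
Qed.

Hypothesis hinv : (1 < k)%N -> (ord tP' < N%:R%:E)%E /\ (ord tQ' < N%:R%:E)%E.

(** A computed parameter that is nonzero to precision N has the valuation of the true one by
    [v_near], so the loss in inverting it is measured by the true valuations. These are nonnegative,
    and the pole of order k is the worst case. *)
Lemma nu3_bound (j : nat) : (j < k)%N ->
  (nu3 p ord N k tP tQ <= ord (term' (j%:Z - k%:Z) - term (j%:Z - k%:Z)))%E.
Proof.
move=> jk; rewrite /nu3.
(* The exponent -1 contributes nothing; for k = 1 it is the only polar one, in accordance with nu3 =
   +oo. *)
have [jk1|jk1] := eqVneq j.+1 k.
  have -> : j%:Z - k%:Z = -1 by lia.
  by rewrite /term' /term /integrated_term eqxx !subrr (ord_zero hC) leey.
have k1 : (1 < k)%N by lia.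
have [m [mE mk mk1 km]] : exists m : nat, [/\ j%:Z - k%:Z = - m.+2%:Z, (m.+2 <= k)%N,
    (m.+1 <= k.-1)%N & - k%:Z <= - m.+2%:Z < l%:Z].
  by exists (k - j - 2)%N; split; lia.
rewrite (gtn_eqF k1).
have near t t' : vge N%:R (t' - t) -> (ord t' < N%:R%:E)%E -> [/\ t != 0, t' != 0 & v t' = v t].
  move=> htt lt; have nt' : t' != 0.
    by apply/eqP => t0; move: lt; rewrite t0 (ord_zero hC) ltNge leey.
  have [||nt vt] := @v_near _ _ _ _ hC t t' N%:R nt'.
  - by rewrite -lte_fin -(ordE hC).
  - by move: (vgeN hC htt); rewrite opprB; apply.
  by split.
have [invP invQ] := hinv k1.
have [nP nP' ePP] := near _ _ hP invP; have [nQ nQ' eQQ] := near _ _ hQ invQ.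
have v_pos t : t != 0 -> (0 < ord t)%E -> 0 <= v t.
  by move=> nt /ltW; rewrite (ordE hC) // lee_fin.
have [vP0 vQ0] := (v_pos _ nP pP, v_pos _ nQ pQ).
rewrite (ordE hC nP) (ordE hC nQ) -EFin_max -EFinM -!EFinB.
have [_ h0] : Zp (a (- m.+2%:Z)) by apply: ha; case/andP: km.
have hi : vge N%:R (at_ (- m.+2%:Z) - a (- m.+2%:Z)) by exact: hat.
rewrite mE /term' /term opprD addrACA -opprD.
have logm : ((trunc_log p m.+1)%:R <= (trunc_log p k.-1)%:R :> R).
  by rewrite ler_nat; exact: leq_trunc_log.
have mk' : (m.+2%:R <= k%:R :> R) by rewrite ler_nat.
have bound t : 0 <= v t -> v t <= Num.max (v tP) (v tQ) ->
    N%:R - k%:R * Num.max (v tP) (v tQ) - (trunc_log p k.-1)%:R <=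
    N%:R - m.+2%:R * v t - (trunc_log p m.+1)%:R.
  move=> t0 tm; apply: lerB => //; apply: lerB => //.
  by apply: ler_pM => //; rewrite ler0n.
apply: (vgeB hC).
  have le_vQ : v tQ <= Num.max (v tP) (v tQ) by rewrite le_max lexx orbT.
  apply: (vge_mono (bound tQ vQ0 le_vQ)).
  exact: (vge_pole_term_error hp hC h0 hi nQ nQ' eQQ vQ0 hQ).
have le_vP : v tP <= Num.max (v tP) (v tQ) by rewrite le_max lexx.
apply: (vge_mono (bound tP vP0 le_vP)).
exact: (vge_pole_term_error hp hC h0 hi nP nP' ePP vP0 hP).
Qed.

Lemma tiny_integral_precision :
  exists2 I : C, tiny_integral ord a k tP tQ I &
    (Order.min (Order.min (nu1 R p e l) (nu2 R p e N l)) (nu3 p ord N k tP tQ)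
     <= ord (partial_integral at_ k tP' tQ' (k + l)%N - I))%E.
Proof.
have [I hI] := tiny_integral_exists; exists I => //.
rewrite -[partial_integral at_ _ _ _ _](subrK (partial_integral a k tP tQ (k + l))) -addrA.
apply: le_trans (ordD hC _ _); rewrite le_min; apply/andP; split; last first.
  by apply: le_trans (nu1_bound l hI); rewrite !ge_min lexx.
rewrite !partial_integralE -sumrB; apply: (ord_sum_ge hC) => j _.
have [jk|kj] := ltnP j k.
  by apply: le_trans (nu3_bound jk); rewrite ge_min lexx orbT.
have -> : j%:Z - k%:Z = (j - k)%N by lia.
apply: (@le_trans _ _ (nu2 R p e N l)); first by rewrite !ge_min lexx orbT.
by apply: nu2_bound; have := ltn_ord j; lia.
Qed.

End FixedData.
End TinyIntegralPrecision.

Local Notation "x %:F" := (tofrac x).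

(** * Function fields *)

Section FractionField.
Import FracField.

Lemma frac_numden (A : idomainType) (w : {fraction A}) :
  w = (\n_(repr w))%:F / (\d_(repr w))%:F.
Proof.
have d0 : (\d_(repr w))%:F != 0 by rewrite tofrac_eq0 denom_ratioP.
apply: (mulIf d0); rewrite mulfVK //.
rewrite -{1}[w]reprK; move: (repr w) => x {d0 w}.
unlock tofrac; rewrite -[LHS]pi_mul.
apply/eqmodP; rewrite /= equivfE /mulf !numden_Ratio ?mulr1 ?oner_eq0 ?denom_ratioP //.
by rewrite mulrC.
Qed.

End FractionField.

Section RatfunMap.
Variables (k K : fieldType) (f : {rmorphism k -> K}).

(** [ratfun_map] is defined through a chosen representative; cross-multiplying shows that every
    other fraction gives the same result. *)
Lemma ratfun_map_frac (a b : {poly k}) : b != 0 ->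
  ratfun_map f (a%:F / b%:F) = (map_poly f a)%:F / (map_poly f b)%:F.
Proof.
move=> nb; rewrite /ratfun_map; set w := a%:F / b%:F.
have nd : \d_(repr w) != 0 by rewrite denom_ratioP.
have /eqP := frac_numden w; rewrite {1}/w eqr_div ?tofrac_eq0 //.
rewrite -!tofracM tofrac_eq => /eqP /(congr1 (map_poly f)); rewrite !rmorphM /= => e.
apply/eqP; rewrite eqr_div ?tofrac_eq0 ?map_poly_eq0 //.
by rewrite -!tofracM tofrac_eq mulrC mulrC e mulrC.
Qed.

Lemma ratfun_map_tofrac (a : {poly k}) : ratfun_map f a%:F = (map_poly f a)%:F.
Proof.
by have := ratfun_map_frac a (oner_neq0 _); rewrite !rmorph1 !divr1.
Qed.

Lemma ratfun_map_zmod_morphism : zmod_morphism (ratfun_map f).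
Proof.
move=> w w'; have nd (x : ratfun k) : \d_(repr x) != 0 by rewrite denom_ratioP.
have nF (x : ratfun k) : (\d_(repr x))%:F != 0 by rewrite tofrac_eq0.
have nm (x : ratfun k) : (map_poly f \d_(repr x))%:F != 0 by rewrite tofrac_eq0 map_poly_eq0.
have -> : w - w' = (\n_(repr w) * \d_(repr w') - \n_(repr w') * \d_(repr w))%:F /
    (\d_(repr w) * \d_(repr w'))%:F.
  rewrite {1}[w]frac_numden {1}[w']frac_numden tofracB !tofracM -mulNr addf_div //.
  by rewrite mulNr.
rewrite ratfun_map_frac ?mulf_neq0 // /ratfun_map -[in RHS]mulNr addf_div //.
by rewrite !rmorphB !rmorphM /= mulNr.
Qed.

Lemma ratfun_map_monoid_morphism : monoid_morphism (ratfun_map f).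
Proof.
split=> [|w w']; first by rewrite -tofrac1 ratfun_map_tofrac rmorph1.
have nd (x : ratfun k) : \d_(repr x) != 0 by rewrite denom_ratioP.
rewrite {1}[w]frac_numden {1}[w']frac_numden mulf_div -!tofracM.
rewrite ratfun_map_frac ?mulf_neq0 // /ratfun_map mulf_div.
by rewrite !rmorphM.
Qed.

HB.instance Definition _ := GRing.isZmodMorphism.Build (ratfun k) (ratfun K)
  (ratfun_map f) ratfun_map_zmod_morphism.
HB.instance Definition _ := GRing.isMonoidMorphism.Build (ratfun k) (ratfun K)
  (ratfun_map f) ratfun_map_monoid_morphism.

End RatfunMap.

Lemma coef_sum_ordX (A : nzRingType) n (c : 'I_n -> A) (i : 'I_n) :
  (\sum_(j < n) c j *: 'X^j : {poly A})`_i = c i.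
Proof.
rewrite coef_sum (bigD1 i) //= coefZ coefXn eqxx mulr1 big1 ?addr0 // => j ji.
by rewrite coefZ coefXn eq_sym -[_ == _]/(j == i) (negbTE ji) mulr0.
Qed.

Lemma size_sum_ordX (A : nzRingType) n (c : 'I_n -> A) :
  (size (\sum_(j < n) c j *: 'X^j : {poly A})%R <= n)%N.
Proof.
apply/(leq_trans (size_sum _ _ _))/bigmax_leqP => j _.
by apply: leq_trans (size_scale_leq _ _) _; rewrite size_polyXn.
Qed.

Section FunctionField.
Variables (Q : {poly {poly int}}) (k : fieldType).
Local Notation FF := (funfield Q k).
Local Notation ev s f := ((map_poly (@tofrac {poly k} \o polyC) f).[s]).

Implicit Types (s : ratfun k).

Lemma sub_atE s (f : {poly k}) : sub_at Q s f = qpolyC _ (map_poly (@tofrac {poly k} \o polyC) f).[s].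
Proof. by []. Qed.

Lemma sub_at_zmod_morphism s : zmod_morphism (@sub_at Q k s).
Proof. by move=> f g; rewrite !sub_atE !rmorphB hornerD hornerN rmorphB. Qed.

Lemma sub_at_monoid_morphism s : monoid_morphism (@sub_at Q k s).
Proof.
split=> [|f g]; first by rewrite sub_atE rmorph1 hornerC.
by rewrite !sub_atE rmorphM hornerM -rmorphM.
Qed.

HB.instance Definition _ s := GRing.isZmodMorphism.Build {poly k} FF
  (@sub_at Q k s) (sub_at_zmod_morphism s).
HB.instance Definition _ s := GRing.isMonoidMorphism.Build {poly k} FF
  (@sub_at Q k s) (sub_at_monoid_morphism s).

Lemma cstE s (c : k) : cst Q c = sub_at Q s c%:P.
Proof. by rewrite /cst !sub_atE !map_polyC !hornerC. Qed.

Lemma cst_zmod_morphism : zmod_morphism (@cst Q k).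
Proof. by move=> c c'; rewrite /cst polyCB rmorphB. Qed.

Lemma cst_monoid_morphism : monoid_morphism (@cst Q k).
Proof. by split=> [|c c']; rewrite /cst ?polyC1 ?rmorph1 // polyCM rmorphM. Qed.

HB.instance Definition _ := GRing.isZmodMorphism.Build k FF (@cst Q k) cst_zmod_morphism.
HB.instance Definition _ := GRing.isMonoidMorphism.Build k FF (@cst Q k) cst_monoid_morphism.

Lemma sub_atX s : sub_at Q s ('X : {poly k}) = qpolyC _ s.
Proof. by rewrite sub_atE map_polyX hornerX. Qed.

Lemma sub_at_scale s (f : {poly k}) (z : FF) : sub_at Q s f * z = (ev s f) *: z.
Proof.
rewrite -[RHS]mul1r -scalerAr scalerAl; congr (_ * _).
by apply/val_inj; rewrite /= -alg_polyC.
Qed.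

Lemma comb0 s (b : 'I_(dx Q) -> FF) : comb s b (fun=> 0) = 0.
Proof. by rewrite /comb big1 // => j _; rewrite rmorph0 mul0r. Qed.

Lemma combD s (b : 'I_(dx Q) -> FF) f g :
  comb s b f + comb s b g = comb s b (fun j => f j + g j).
Proof. by rewrite -big_split; apply: eq_bigr => j _; rewrite rmorphD mulrDl. Qed.

Lemma combN s (b : 'I_(dx Q) -> FF) f : - comb s b f = comb s b (fun j => - f j).
Proof. by rewrite -sumrN; apply: eq_bigr => j _; rewrite rmorphN mulNr. Qed.

Lemma combZ s (b : 'I_(dx Q) -> FF) (g : {poly k}) f :
  sub_at Q s g * comb s b f = comb s b (fun j => g * f j).
Proof. by rewrite mulr_sumr; apply: eq_bigr => j _; rewrite rmorphM mulrA. Qed.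

Lemma comb_delta s (b : 'I_(dx Q) -> FF) j : comb s b (fun i => (i == j)%:R) = b j.
Proof.
rewrite /comb (bigD1 j) //= eqxx rmorph1 mul1r big1 ?addr0 // => i ij.
by rewrite (negbTE ij) rmorph0 mul0r.
Qed.

Hypotheses (Qmonic : Q \is monic) (Qsize : (1 < size Q)%N).
Local Notation h := (map_poly (fun f : {poly k} => f%:F) (Qover Q k)).

(** The quotient is formed modulo [mk_monic h], which is h itself only for h monic of positive
    degree and a default modulus otherwise. *)
Lemma Qover_mk_monic : mk_monic h = h /\ size h = (dx Q).+1.
Proof.
have monQ : Qover Q k \is monic := monic_map (map_poly (intr : {rmorphism int -> k})) Qmonic.
have mon : h \is monic := monic_map (@tofrac {poly k}) monQ.
have sz : size h = (dx Q).+1.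
  rewrite (size_map_poly_id0 (f := @tofrac {poly k})); last first.
    by rewrite (monicP monQ) rmorph1 oner_eq0.
  rewrite (size_map_poly_id0 (f := map_poly (intr : int -> k))).
    by rewrite /dx prednK // ltnW.
  by rewrite (monicP Qmonic) rmorph1 oner_eq0.
have d0 : (0 < dx Q)%N by rewrite /dx -ltnS prednK // ltnW.
by rewrite /mk_monic sz mon ltnS d0.
Qed.

(** In the chart at infinity, multiplying f(1/x) by a power of x gives a polynomial with the
    coefficients of f in reverse order. *)
Lemma coord_transcendental infty (f : {poly k}) : ev (chart_coord k infty) f = 0 -> f = 0.
Proof.
case: infty => /= /eqP; last first.
  rewrite (map_poly_comp (@tofrac {poly k}) polyC) horner_map /= tofrac_eq0.
  by rewrite -[_.['X]]/(f \Po 'X) comp_polyXr => /eqP.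
have nX : ('X : {poly k})%:F != 0 by rewrite tofrac_eq0 polyX_eq0.
move=> /eqP f0; apply/polyP => i; rewrite coef0.
have [si|is_] := leqP (size f) i; first by rewrite nth_default.
have : (\sum_(j < size f) f`_j *: 'X^(size f - j) : {poly k})%:F = 0.
  rewrite -[RHS](mulr0 ('X%:F ^+ size f)) -f0 horner_coef size_map_poly_id0; last first.
    by rewrite /= tofrac_eq0 polyC_eq0 lead_coef_eq0 -size_poly_gt0; apply: leq_ltn_trans is_.
  rewrite rmorph_sum mulr_sumr; apply: eq_bigr => j _ /=.
  rewrite coef_map /= -mul_polyC tofracM tofracXn mulrCA; congr (_ * _).
  by rewrite exprVn expfB.
move/eqP; rewrite tofrac_eq0 => /eqP /polyP/(_ (size f - i)%N).
rewrite coef0 coef_sum (bigD1 (Ordinal is_)) //= coefZ coefXn eqxx mulr1 big1 ?addr0 //.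
move=> j /eqP ji; rewrite coefZ coefXn; case: eqP => [e|]; rewrite ?mulr0 //.
by case: ji; apply/val_inj => /=; have := ltn_ord j; lia.
Qed.

Lemma basis_comb s (W : 'M[ratfun k]_(dx Q)) f :
  comb s (Defs.basis_of W) f =
  in_qpoly h (\sum_(i < dx Q) (\sum_j W i j * ev s (f j)) *: 'X^i).
Proof.
rewrite /comb /Defs.basis_of linear_sum.
transitivity (\sum_j \sum_(i < dx Q) (W i j * ev s (f j)) *: (qpolyX h) ^+ i).
  apply: eq_bigr => j _; rewrite sub_at_scale scaler_sumr; apply: eq_bigr => i _.
  by rewrite scalerA mulrC.
rewrite exchange_big; apply: eq_bigr => i _.
by rewrite -scaler_suml linearZ /= rmorphXn.
Qed.

(** In the basis 1, y, ..., y^(d-1), the coordinates of a combination are W applied to its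
    coefficients, and W is invertible. This makes values at points well defined. *)
Lemma comb_basis_inj infty (W : 'M[ratfun k]_(dx Q)) f : W \in unitmx ->
  comb (chart_coord k infty) (Defs.basis_of W) f = 0 -> forall j, f j = 0.
Proof.
move=> uW; set s := chart_coord k infty; rewrite basis_comb.
move/(congr1 (@polyn _ _)); have [hm hs] := Qover_mk_monic.
rewrite in_qpoly_small; last by rewrite hm hs ltnS; exact: size_sum_ordX.
move=> e0 j; apply: (@coord_transcendental infty); rewrite -/s.
have WF : W *m \col_i ev s (f i) = 0.
  apply/colP => i; rewrite !mxE.
  have := congr1 (fun P : {poly ratfun k} => P`_i) e0; rewrite /= coef_sum_ordX => e1.
  apply: etrans (etrans e1 (coef0 _ i)).
  by apply: eq_bigr => l _; rewrite mxE.
have /colP/(_ j) := congr1 (mulmx (invmx W)) WF.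
by rewrite mulKmx // mulmx0 !mxE.
Qed.

End FunctionField.

(** * Base change of the function field *)

Section Transfer.
Variables (Q : {poly {poly int}}) (k K : fieldType) (f : {rmorphism k -> K}).
Hypotheses (Qmonic : Q \is monic) (Qsize : (1 < size Q)%N).
Local Notation ho L := (map_poly (fun g : {poly L} => g%:F) (Qover Q L)).
Local Notation iota := (ratfun_map f).

Lemma map_modulus : map_poly iota (ho k) = ho K.
Proof.
apply/polyP => i; rewrite !coef_map_id0 ?rmorph0 ?tofrac0 //.
rewrite ratfun_map_tofrac; congr (_%:F).
by apply/polyP => j; rewrite !coef_map /= rmorph_int.
Qed.

(** The modulus over k maps to the one over K, so congruences are preserved; [funfield_map], defined
    on remainders, is multiplicative for this reason. *)
Lemma in_qpoly_map_eq (F G : {poly ratfun k}) : in_qpoly (ho k) F = in_qpoly (ho k) G ->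
  in_qpoly (ho K) (map_poly iota F) = in_qpoly (ho K) (map_poly iota G).
Proof.
have [hm _] := Qover_mk_monic k Qmonic Qsize.
have [hm' _] := Qover_mk_monic K Qmonic Qsize.
have mon := monic_mk_monic (ho k); rewrite hm in mon.
move=> /(congr1 (@polyn _ _)) /= e.
have h0 : in_qpoly (ho K) (map_poly iota (ho k)) = 0.
  rewrite map_modulus; apply/val_inj; rewrite /= hm'.
  by have := monic_mk_monic (ho K); rewrite hm' => /Pdiv.RingMonic.rmodpp.
have red P : in_qpoly (ho K) (map_poly iota P) =
    in_qpoly (ho K) (map_poly iota (Pdiv.CommonRing.rmodp P (ho k))).
  rewrite {1}(Pdiv.RingMonic.rdivp_eq mon P) rmorphD rmorphM /=.
  by rewrite in_qpolyD in_qpolyM h0 mulr0 add0r.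
by rewrite red [RHS]red; move: e; rewrite hm => ->.
Qed.

Definition funfield_map (z : funfield Q k) : funfield Q K :=
  in_qpoly (ho K) (map_poly iota (polyn z)).

Lemma in_qpoly_val (z : funfield Q k) : in_qpoly (ho k) (polyn z) = z.
Proof. by apply: val_inj; apply: in_qpoly_small; exact: size_mk_monic. Qed.

Lemma funfield_map_in F :
  funfield_map (in_qpoly (ho k) F) = in_qpoly (ho K) (map_poly iota F).
Proof. apply: in_qpoly_map_eq; exact: in_qpoly_val. Qed.

Lemma funfield_map_zmod_morphism : zmod_morphism funfield_map.
Proof.
by move=> z w; rewrite /funfield_map /= !rmorphB.
Qed.

Lemma funfield_map_monoid_morphism : monoid_morphism funfield_map.
Proof.
split=> [|z w]; first by rewrite -[1](in_qpoly1 (ho k)) funfield_map_in !rmorph1.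
by rewrite -[z]in_qpoly_val -[w]in_qpoly_val -in_qpolyM !funfield_map_in rmorphM in_qpolyM.
Qed.

Lemma funfield_map_qpolyC c : funfield_map (qpolyC _ c) = qpolyC _ (iota c).
Proof.
rewrite -[qpolyC _ c]in_qpoly_val funfield_map_in map_polyC; apply: val_inj.
by apply: in_qpoly_small; rewrite (leq_ltn_trans (size_polyC_leq1 _)) // size_mk_monic_gt1.
Qed.

Lemma funfield_map_sub_at s g :
  funfield_map (sub_at Q s g) = sub_at Q (iota s) (map_poly f g).
Proof.
rewrite !sub_atE funfield_map_qpolyC -horner_map; congr (qpolyC _ _.[_]).
by apply/polyP => i; rewrite !coef_map /= ratfun_map_tofrac map_polyC.
Qed.

Lemma funfield_map_basis W j :
  funfield_map (Defs.basis_of W j) = Defs.basis_of (map_mx iota W : 'M[ratfun K]_(dx Q)) j.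
Proof.
have basisE (L : fieldType) (V : 'M[ratfun L]_(dx Q)) :
    Defs.basis_of V j = in_qpoly (ho L) (\sum_(i < dx Q) V i j *: 'X^i).
  by rewrite /Defs.basis_of linear_sum; apply: eq_bigr => i _; rewrite linearZ /= rmorphXn.
rewrite !basisE funfield_map_in; congr in_qpoly.
rewrite rmorph_sum; apply: eq_bigr => i _.
by rewrite mxE /= map_polyZ map_polyXn.
Qed.

Definition funfield_rmorph : {rmorphism funfield Q k -> funfield Q K} :=
  HB.pack funfield_map
    (GRing.isZmodMorphism.Build _ _ _ funfield_map_zmod_morphism)
    (GRing.isMonoidMorphism.Build _ _ _ funfield_map_monoid_morphism).

End Transfer.

(** * Integrality in the two charts *)

Section IntegralBasis.
Variables (Q : {poly {poly int}}) (k : fieldType).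
Local Notation FF := (funfield Q k).
Implicit Types (s : ratfun k) (b : 'I_(dx Q) -> FF).

Lemma sub_at_coef s (g : {poly k}) :
  sub_at Q s g = \sum_(j < size g) cst Q g`_j * sub_at Q s ('X : {poly k}) ^+ j.
Proof.
rewrite -[in LHS](coefK g) poly_def rmorph_sum; apply: eq_bigr => j _.
by rewrite -mul_polyC rmorphM rmorphXn /= -cstE.
Qed.

Lemma integral_basis_one s b : integral_basis s b -> exists g, 1 = comb s b g.
Proof. by move=> [h _]; apply/h; exact: (integral1 (sub_at Q s)). Qed.

Lemma integral_basis_mul s b i j : integral_basis s b -> exists g, b i * b j = comb s b g.
Proof.
move=> [h _]; apply/h; apply: (integral_mul (RtoK := sub_at Q s));
  by apply/h; eexists; rewrite -(comb_delta s).
Qed.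

(** Let u = 1/x. Multiplied by u^(m n), the equation G(z) = 0 of degree n becomes monic in u^m z,
    with coefficients u^(m(n-i)) G_i(x); these are polynomials in u once m bounds the degrees of the
    G_i. *)
Lemma integral_at_infinity z :
  integralOver (sub_at Q (chart_coord k false)) z ->
  exists m, integralOver (sub_at Q (chart_coord k true))
    (sub_at Q (chart_coord k true) ('X : {poly k}) ^+ m * z).
Proof.
move=> [G Gmon /eqP]; rewrite horner_coef (size_map_poly_id0 (f := sub_at Q _)); last first.
  by rewrite (monicP Gmon) rmorph1 oner_eq0.
set x0 := chart_coord k false; set x1 := chart_coord k true => G0.
set n := (size G).-1.
have sG : size G = n.+1 by rewrite /n prednK // size_poly_gt0 monic_neq0.
pose m := (\max_(i < size G) size (G`_i)%R)%N.
pose u : FF := sub_at Q x1 'X; pose y : FF := sub_at Q x0 'X.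
have uy : u * y = 1.
  rewrite /u /y !sub_atX -qpolyCM /x0 /x1 /= mulVf //.
  by rewrite tofrac_eq0 polyX_eq0.
have uyX d j : (j <= d)%N -> u ^+ (d - j) = u ^+ d * y ^+ j.
  by move=> jd; rewrite -{2}(subnK jd) exprD -mulrA -exprMn uy expr1n mulr1.
pose H i : {poly k} := if i == n then 1 else \sum_(j < size G`_i) G`_i`_j *: 'X^(m * (n - i) - j).
have HE i : (i < n.+1)%N -> sub_at Q x1 (H i) * u ^+ (m * i) = u ^+ (m * n) * sub_at Q x0 G`_i.
  rewrite ltnS leq_eqVlt /H => /orP[/eqP ->|lt].
    have -> : G`_n = 1 by rewrite -(monicP Gmon) lead_coefE.
    by rewrite eqxx !rmorph1 mul1r mulr1.
  rewrite (ltn_eqF lt) rmorph_sum mulr_suml sub_at_coef mulr_sumr; apply: eq_bigr => j _.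
  have jm : (j <= m * (n - i))%N.
    have i_lt : (i < size G)%N by rewrite sG ltnW.
    have : (size (G`_i)%R <= m)%N by exact: (leq_bigmax (Ordinal i_lt)).
    move=> /(leq_trans (ltn_ord j)) /ltnW /leq_trans; apply.
    by rewrite leq_pmulr // subn_gt0.
  rewrite -mul_polyC rmorphM rmorphXn /= -cstE -/u -/y uyX //.
  have -> : u ^+ (m * n) = u ^+ (m * (n - i)) * u ^+ (m * i).
    by rewrite -exprD -mulnDr subnK // ltnW.
  move: (cst _ _) (_ ^+ j) (_ ^+ (m * i)) (u ^+ (m * (n - i))) => c1 c2 c3 c4.
  by ring.
exists m; exists (\poly_(i < n.+1) H i).
  rewrite monicE lead_coefE size_poly_eq; last by rewrite /H eqxx oner_eq0.
  by rewrite coef_poly ltnSn /H eqxx.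
apply/eqP; rewrite horner_coef (size_map_poly_id0 (f := sub_at Q _)); last first.
  rewrite lead_coefE size_poly_eq; last by rewrite /H eqxx oner_eq0.
  by rewrite coef_poly ltnSn /H eqxx rmorph1 oner_eq0.
rewrite size_poly_eq; last by rewrite /H eqxx oner_eq0.
rewrite -[RHS](mulr0 (u ^+ (m * n))) -[in RHS]G0 sG mulr_sumr; apply: eq_bigr => i _.
rewrite !coef_map coef_poly ltn_ord /= exprMn -exprM mulrA HE // mulrA //.
Qed.

End IntegralBasis.

(** * The charts over C *)

Section Chart.
Variables (T : triple) (r : {poly int}) (hT : curve_triple T r).
Local Notation Q := (plane_eqn T).
Local Notation d := (dx Q).

Lemma plane_eqn_monic : Q \is monic. Proof. by case: hT => -[]. Qed.

Lemma plane_eqn_size : (1 < size Q)%N.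
Proof.
have [[[Q0 Qu _] mon] _ _ _ _] := hT.
rewrite ltnNge; apply/negP => s1; have s1' : size Q = 1%N.
  by apply/eqP; rewrite eqn_leq s1 size_poly_gt0.
move: Qu; have := mon; rewrite monicE lead_coefE s1' /= => /eqP e.
by rewrite (size1_polyC s1) e unitr1.
Qed.

Variables (C : closedFieldType) (f : {rmorphism rat -> C}).
Hypothesis fE : f =1 ratr.
Local Notation FC := (funfield Q C).
Local Notation coord infty := (chart_coord C infty).
Local Notation basis := (@chart_basis C T).
Local Notation Phi := (funfield_rmorph f plane_eqn_monic plane_eqn_size).

Lemma chart_coord_map infty : ratfun_map f (chart_coord rat infty) = coord infty.
Proof.
by case: infty => /=; rewrite 1?[LHS]fmorphV /= ratfun_map_tofrac map_polyX.
Qed.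

Lemma chart_basis_map infty j :
  Phi (Defs.basis_of (chart_mx T infty) j) = basis infty j.
Proof.
rewrite /= (funfield_map_basis _ plane_eqn_monic plane_eqn_size).
rewrite /chart_basis /mx_over; congr (Defs.basis_of (map_mx (ratfun_map _) _) _).
exact/funext.
Qed.

Lemma comb_map infty infty' g :
  Phi (comb (chart_coord rat infty) (Defs.basis_of (chart_mx T infty')) g) =
  comb (coord infty) (basis infty') (fun j => map_poly f (g j)).
Proof.
rewrite rmorph_sum; apply: eq_bigr => j _; rewrite rmorphM chart_basis_map.
by rewrite /= (funfield_map_sub_at _ plane_eqn_monic plane_eqn_size) chart_coord_map.
Qed.

Lemma chart_integral_basis infty :
  integral_basis (chart_coord rat infty) (Defs.basis_of (chart_mx T infty)).
Proof. by case: hT. Qed.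

Lemma chart_one infty : exists g : 'I_d -> {poly rat},
  1 = comb (coord infty) (basis infty) (fun j => map_poly f (g j)).
Proof.
have [g /(congr1 Phi)] := integral_basis_one (chart_integral_basis infty).
by rewrite rmorph1 comb_map => e; exists g.
Qed.

Lemma chart_mul infty i j : exists g : 'I_d -> {poly rat},
  basis infty i * basis infty j =
  comb (coord infty) (basis infty) (fun l => map_poly f (g l)).
Proof.
have [g /(congr1 Phi)] := integral_basis_mul i j (chart_integral_basis infty).
by rewrite rmorphM comb_map !chart_basis_map => e; exists g.
Qed.

(** This allows functions of the finite chart to be evaluated at points of the infinite chart where
    1/x is nonzero. *)
Lemma chart_at_infinity j : exists m (g : 'I_d -> {poly rat}),
  sub_at Q (coord true) 'X ^+ m * basis false j =
  comb (coord true) (basis true) (fun l => map_poly f (g l)).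
Proof.
have [int0 _] := chart_integral_basis false.
have [|m hm] := @integral_at_infinity Q rat (Defs.basis_of (chart_mx T false) j).
  by apply/int0; eexists; rewrite -(comb_delta (chart_coord rat false)).
have [int1 _] := chart_integral_basis true.
have /int1 [g /(congr1 Phi)] := hm.
rewrite rmorphM rmorphXn comb_map chart_basis_map /=.
rewrite (funfield_map_sub_at _ plane_eqn_monic plane_eqn_size).
by rewrite (chart_coord_map true) map_polyX => e; exists m, g.
Qed.

End Chart.

(** * Very bad points *)

Section ChartRing.
Variables (T : triple) (C : closedFieldType) (infty : bool).
Local Notation Q := (plane_eqn T).
Local Notation FC := (funfield Q C).
Local Notation s := (chart_coord C infty).
Local Notation basis := (@chart_basis C T infty).

(** What makes [chart_ring S] stable under sums and under multiplication by polynomials over S; S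
    will be Z_p, Q_p or C. *)
Definition semiring_set (S : set C) : Prop :=
  [/\ S 0, S 1, forall z w, S z -> S w -> S (z + w) & forall z w, S z -> S w -> S (z * w)].

Variables (S : set C) (hS : semiring_set S).
Local Notation A := (@chart_ring C T S infty).

Lemma coefs_inD (g h : {poly C}) : coefs_in S g -> coefs_in S h -> coefs_in S (g + h).
Proof. by case: hS => _ _ SD _ hg hh i; rewrite coefD; exact: SD. Qed.

Lemma coefs_inM (g h : {poly C}) : coefs_in S g -> coefs_in S h -> coefs_in S (g * h).
Proof.
case: hS => S0 _ SD SM hg hh i; rewrite coefM; apply: big_ind => // j _; exact: SM.
Qed.

Lemma coefs_inC (c : C) : S c -> coefs_in S c%:P.
Proof. by case: hS => S0 _ _ _ Sc i; rewrite coefC; case: eqP. Qed.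

Lemma coefs_inX : coefs_in S 'X.
Proof. by case: hS => S0 S1 _ _ i; rewrite coefX; case: eqP. Qed.

Lemma coefs_in_nat n : coefs_in S n%:R.
Proof.
case: hS => S0 S1 SD _; rewrite -polyC_natr; apply: coefs_inC.
by elim: n => // n IH; rewrite mulrS; exact: SD.
Qed.

Lemma chart_ring0 : A 0.
Proof. by exists (fun=> 0); rewrite comb0; split=> // j; exact: (coefs_in_nat 0). Qed.

Lemma chart_ringD z w : A z -> A w -> A (z + w).
Proof.
move=> [g [hg ->]] [h [hh ->]]; exists (fun j => g j + h j); rewrite combD; split=> // j.
exact: coefs_inD.
Qed.

Lemma chart_ring_sum (I : Type) (t : seq I) (P : pred I) (F : I -> FC) :
  (forall i, P i -> A (F i)) -> A (\sum_(i <- t | P i) F i).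
Proof. by move=> h; apply: big_ind => //; [exact: chart_ring0 | exact: chart_ringD]. Qed.

Lemma chart_ringZ g z : coefs_in S g -> A z -> A (sub_at Q s g * z).
Proof.
move=> hg [h [hh ->]]; exists (fun j => g * h j); rewrite combZ; split=> // j.
exact: coefs_inM.
Qed.

Lemma chart_ring_cst c z : S c -> A z -> A (cst Q c * z).
Proof. by move=> Sc Az; rewrite (cstE Q s); apply: chart_ringZ => //; exact: coefs_inC. Qed.

Lemma chart_ring_basis j : A (basis j).
Proof.
exists (fun i => (i == j)%:R); rewrite comb_delta; split=> // i; exact: coefs_in_nat.
Qed.

Variables (r : {poly int}) (hT : curve_triple T r) (f : {rmorphism rat -> C}).
Hypotheses (fE : f =1 ratr) (S_rat : forall q, S (f q)).

Lemma coefs_in_rat (g : {poly rat}) : coefs_in S (map_poly f g).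
Proof. by move=> i; rewrite coef_map; exact: S_rat. Qed.

Lemma chart_ring1 : A 1.
Proof.
have [g e] := chart_one hT fE infty; exists (fun j => map_poly f (g j)); split=> // j.
exact: coefs_in_rat.
Qed.

(** Products of basis elements have rational coefficients, so S has to contain Q; this covers Q_p
    and C but not Z_p. *)
Lemma chart_ringM z w : A z -> A w -> A (z * w).
Proof.
move=> [g [hg ->]] Aw; rewrite /comb mulr_suml; apply: chart_ring_sum => j _.
rewrite -mulrA; apply: chart_ringZ => //; move: Aw => [h [hh ->]].
rewrite /comb mulr_sumr; apply: chart_ring_sum => l _.
rewrite mulrCA; apply: chart_ringZ => //.
have [g' ->] := chart_mul hT fE infty j l.
by exists (fun j => map_poly f (g' j)); split=> // i; exact: coefs_in_rat.
Qed.

Lemma chart_ringX z n : A z -> A (z ^+ n).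
Proof.
by move=> Az; elim: n => [|n IH]; [exact: chart_ring1 | rewrite exprS; exact: chart_ringM].
Qed.

Variable u : FC.

(** Each term of the binomial expansion of (z + w)^(n + m) contains z^n or w^m; D is the set of
    multiples of u. *)
Lemma rad_addr z w : Defs.rad A u z -> Defs.rad A u w -> Defs.rad A u (z + w).
Proof.
move=> [Az [n [z' [Az' ez]]]] [Aw [m [w' [Aw' ew]]]]; split; first exact: chart_ringD.
exists (n + m)%N.
pose D y := exists t, A t /\ y = u * t.
have DD y y' : D y -> D y' -> D (y + y').
  by move=> [t [At ->]] [t' [At' ->]]; exists (t + t'); rewrite mulrDr; split=> //; exact: chart_ringD.
have DM y y' : D y -> A y' -> D (y * y').
  by move=> [t [At ->]] Ay'; exists (t * y'); rewrite mulrA; split=> //; exact: chart_ringM.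
have D0 : D 0 by exists 0; rewrite mulr0; split=> //; exact: chart_ring0.
suff : D ((z + w) ^+ (n + m)) by [].
rewrite exprDn; apply: (big_ind D) => // i _.
suff Di : D (z ^+ (n + m - i) * w ^+ i).
  by elim: ('C(_, _)) => [|c IH]; rewrite ?mulr0n // mulrS; exact: DD.
have [mi|im] := leqP m i.
  rewrite mulrC -(subnK mi) exprD [w ^+ _ * w ^+ m]mulrC -mulrA; apply: DM.
    by exists w'.
  by apply: chart_ringM; exact: chart_ringX.
have -> : (n + m - i = n + (m - i))%N by lia.
by rewrite exprD -mulrA; apply: DM; [exists z' | apply: chart_ringM; exact: chart_ringX].
Qed.

Lemma rad_mulr z w : Defs.rad A u z -> A w -> Defs.rad A u (z * w).
Proof.
move=> [Az [n [z' [Az' ez]]]] Aw; split; first exact: chart_ringM.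
exists n, (z' * w ^+ n); rewrite exprMn ez mulrA; split=> //.
by apply: chart_ringM => //; exact: chart_ringX.
Qed.

Lemma rad_zero : Defs.rad A u 0.
Proof.
split; first exact: chart_ring0.
by exists 1%N, 0; rewrite mulr0; split=> //; exact: chart_ring0.
Qed.

Lemma rad_sum (I : Type) (t : seq I) (P : pred I) (F : I -> FC) :
  (forall i, P i -> Defs.rad A u (F i)) -> Defs.rad A u (\sum_(i <- t | P i) F i).
Proof. by move=> h; apply: big_ind => //; [exact: rad_zero | exact: rad_addr]. Qed.

Lemma chart_ring_scalar c : S c -> A (cst Q c).
Proof. by move=> Sc; rewrite -[cst Q c]mulr1; apply: chart_ring_cst => //; exact: chart_ring1. Qed.

End ChartRing.

(** The right-hand side collects the errors made in expanding first e_i e_j and then each e_n e_l;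
    it lies in every ideal containing the defects of the multiplication table. *)
Lemma triple_product_identity (A : comNzRingType) q (e : 'I_q -> A)
    (m : 'I_q -> 'I_q -> 'I_q -> A) i j l :
  e i * e j * e l - \sum_t (\sum_n m i j n * m n l t) * e t =
  (e i * e j - \sum_n m i j n * e n) * e l +
  \sum_n (e n * e l - \sum_t m n l t * e t) * m i j n.
Proof.
rewrite mulrBl -addrA; congr (_ + _).
under [X in _ + X]eq_bigr do rewrite mulrBl.
rewrite sumrB mulr_suml addrA.
have -> : \sum_n e n * e l * m i j n = \sum_n m i j n * e n * e l.
  by apply: eq_bigr => n _; rewrite mulrC mulrA.
rewrite addNr add0r; congr (- _).
under [RHS]eq_bigr do rewrite mulr_suml.
rewrite exchange_big; apply: eq_bigr => t _.
by rewrite mulr_suml; apply: eq_bigr => n _; rewrite -mulrA mulrC.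
Qed.

(** * The etale algebra of a very bad locus *)

Section EtaleChart.
Variables (R : realType) (p : nat) (C : closedFieldType) (ord : C -> \bar R).
Hypotheses (hp : prime p) (hC : padic_closure p ord).
Variables (T : triple) (r : {poly int}) (hT : curve_triple T r) (infty : bool).

Local Notation Qp := (padic_num ord).
Local Notation Zp := (padic_int ord).
Local Notation vge := (vge ord).
Local Notation Q := (plane_eqn T).
Local Notation FC := (funfield Q C).
Local Notation AZ := (@chart_ring C T Zp infty).
Local Notation AQ := (@chart_ring C T Qp infty).
Local Notation AC := (@chart_ring C T setT infty).
Local Notation f := (ratrC hp hC).

Lemma ratrCE : f =1 ratr. Proof. by []. Qed.

Lemma Zp_semiring : semiring_set Zp.
Proof.
split; [exact: (padic_int0 hp hC) | exact: (padic_int1 hp hC) | |] => z w.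
  exact: (padic_intD hp hC).
exact: (padic_intM hp hC).
Qed.

Lemma Qp_semiring : semiring_set Qp.
Proof.
split; [exact: (padic_num0 hp hC) | exact: (padic_num1 hp hC) | |] => z w.
  exact: (padic_numD hp hC).
exact: (padic_numM hp hC).
Qed.

Lemma setT_semiring : semiring_set (setT : set C). Proof. by []. Qed.

Lemma chart_ring_sub S S' z : S `<=` S' -> @chart_ring C T S infty z -> chart_ring S' infty z.
Proof. by move=> SS' [g [hg ->]]; exists g; split=> // j i; exact/SS'/hg. Qed.

Lemma AZ_AQ z : AZ z -> AQ z.
Proof. by apply: chart_ring_sub => c []. Qed.

Lemma AQ_scale z : AQ z -> exists m, AZ (cst Q (p%:R ^+ m) * z).
Proof.
move=> [g [hg ->]].
have pZ m : Zp (p%:R ^+ m) by apply: (padic_intX hp hC); exact: (padic_int_nat hp hC).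
have [m hm] : exists m, forall j i, Zp (p%:R ^+ m * (g j)`_i).
  have /choice [n hn] : forall ji : {j : 'I_(dx Q) & 'I_(size (g j))},
      exists m, Zp (p%:R ^+ m * (g (tag ji))`_(tagged ji)).
    by move=> ji; apply: (padic_num_scale_Zp hp hC); exact: hg.
  exists (\max_ji n ji) => j i.
  have [gi|ig] := leqP (size (g j)) i; first by rewrite nth_default // mulr0; exact: (padic_int0 hp hC).
  have le := leq_bigmax (Tagged (fun j => 'I_(size (g j))) (Ordinal ig)) : (n _ <= \max_ji n ji)%N.
  by rewrite -(subnK le) exprD -mulrA; apply: (padic_intM hp hC) => //; exact: hn.
exists m, (fun j => (p%:R ^+ m)%:P * g j); split=> [j i|]; first by rewrite coefCM.
by rewrite (cstE Q (chart_coord C infty)) combZ.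
Qed.

Variable u : FC.

Section Structure.
Variables (q : nat) (e : 'I_q -> FC) (m : 'I_q -> 'I_q -> 'I_q -> C).
Let lin (c : 'I_q -> C) := \sum_i cst Q (c i) * e i.
Hypothesis eA : forall i, AZ (e i).
Hypothesis lin_inj : forall c, (forall i, Zp (c i)) -> Defs.rad AZ u (lin c) ->
  forall i, c i = 0.
Hypothesis mul_e : forall i j, (forall n, Zp (m i j n)) /\
  Defs.rad AZ u (e i * e j - lin (m i j)).

Local Notation congr0 := (Defs.rad AQ u).

Lemma lin_AZ c : (forall i, Zp (c i)) -> AZ (lin c).
Proof.
by move=> hc; apply: (chart_ring_sum Zp_semiring) => i _; exact: (chart_ring_cst Zp_semiring).
Qed.

Lemma rad_AZ_AQ z : Defs.rad AZ u z -> congr0 z.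
Proof.
move=> [Az [n [w [Aw ez]]]]; split; first exact: AZ_AQ.
by exists n, w; split=> //; exact: AZ_AQ.
Qed.

(** Independence modulo the radical survives the passage to Q_p: if lin(c)^n = u w', then replacing
    c by p^k c clears the denominators of w'. *)
Lemma lin_inj_AQ c : (forall i, Zp (c i)) -> congr0 (lin c) -> forall i, c i = 0.
Proof.
move=> hc [_ [n [w [Aw ez]]]].
(* A positive exponent is needed, so that the power of p^k c supplies a factor p^k for w'. *)
have [n0 [w' [Aw' ez']]] : exists n' w', AQ w' /\ lin c ^+ n'.+1 = u * w'.
  exists n, (w * lin c); split; last by rewrite exprSr ez mulrA.
  by apply: (chart_ringM Qp_semiring hT ratrCE (padic_num_rat hp hC)) => //; exact/AZ_AQ/lin_AZ.
have [k hk] := AQ_scale Aw'.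
have pZ j : Zp (p%:R ^+ j) by apply: (padic_intX hp hC); exact: (padic_int_nat hp hC).
have linZ : lin (fun i => p%:R ^+ k * c i) = cst Q (p%:R ^+ k) * lin c.
  by rewrite mulr_sumr; apply: eq_bigr => i _; rewrite rmorphM mulrA.
have := @lin_inj (fun i => p%:R ^+ k * c i); rewrite linZ => h i.
have {h} : p%:R ^+ k * c i = 0.
  apply: h => [j|]; first exact: (padic_intM hp hC).
  split; first by apply: (chart_ring_cst Zp_semiring) => //; exact: lin_AZ.
  exists n0.+1, (cst Q (p%:R ^+ k) ^+ n0 * (cst Q (p%:R ^+ k) * w')); split.
    by rewrite -rmorphXn; apply: (chart_ring_cst Zp_semiring) => //; rewrite -exprM.
  by rewrite exprMn ez' exprSr -!mulrA [RHS]mulrCA; congr (_ * _); rewrite mulrCA.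
by move/eqP; rewrite mulf_eq0 expf_eq0 (negbTE (p_neq0 hC)) andbF => /eqP.
Qed.

Lemma lin_congr c c' z : (forall i, Zp (c i)) -> (forall i, Zp (c' i)) ->
  congr0 (z - lin c) -> congr0 (z - lin c') -> forall i, c i = c' i.
Proof.
move=> hc hc' h h' i; apply/eqP; rewrite -subr_eq0; apply/eqP.
apply: (@lin_inj_AQ (fun i => c i - c' i)) => [j|]; first exact: (padic_intB hp hC).
have -> : lin (fun i => c i - c' i) = (z - lin c') + (z - lin c) * cst Q (- 1).
  rewrite rmorphN1 mulrN1 opprB [RHS]addrC addrA subrK.
  rewrite -sumrB; apply: eq_bigr => j _.
  by rewrite rmorphB mulrBl.
have h1 : Qp (- 1) by apply: (padic_numN hp hC); exact: (padic_num1 hp hC).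
apply: (rad_addr Qp_semiring hT ratrCE (padic_num_rat hp hC)) => //.
apply: (rad_mulr Qp_semiring hT ratrCE (padic_num_rat hp hC)) => //.
exact: (chart_ring_scalar infty Qp_semiring hT ratrCE (padic_num_rat hp hC)).
Qed.

Lemma structure_comm i j n : m i j n = m j i n.
Proof.
apply: (@lin_congr _ _ (e i * e j)); [by case: (mul_e i j) | by case: (mul_e j i) | |].
  by apply: rad_AZ_AQ; case: (mul_e i j).
by rewrite mulrC; apply: rad_AZ_AQ; case: (mul_e j i).
Qed.

Lemma triple_product i j l :
  congr0 (e i * e j * e l - lin (fun t => \sum_n m i j n * m n l t)).
Proof.
have -> : e i * e j * e l - lin (fun t => \sum_n m i j n * m n l t) =
   (e i * e j - lin (m i j)) * e l + \sum_n (e n * e l - lin (m n l)) * cst Q (m i j n).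
  rewrite /lin -(triple_product_identity e (fun i j n => cst Q (m i j n))); congr (_ - _); apply: eq_bigr => t _.
  congr (_ * _); rewrite rmorph_sum; apply: eq_bigr => n _; exact: rmorphM.
have m_AQ n : AQ (cst Q (m i j n)).
  apply: (chart_ring_scalar infty Qp_semiring hT ratrCE (padic_num_rat hp hC)).
  by have [/(_ n)[]] := mul_e i j.
apply: (rad_addr Qp_semiring hT ratrCE (padic_num_rat hp hC)).
  apply: (rad_mulr Qp_semiring hT ratrCE (padic_num_rat hp hC)); last exact: AZ_AQ.
  by apply: rad_AZ_AQ; case: (mul_e i j).
apply: (rad_sum Qp_semiring hT ratrCE (padic_num_rat hp hC)) => n _.
apply: (rad_mulr Qp_semiring hT ratrCE (padic_num_rat hp hC)) => //.
by apply: rad_AZ_AQ; case: (mul_e n l).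
Qed.

(** The multiplication table holds only modulo the radical; associativity follows from uniqueness of
    the coordinates of e_i e_j e_l there. *)
Lemma structure_assoc i j l t : \sum_n m i j n * m n l t = \sum_n m j l n * m i n t.
Proof.
have m_Zp a b n : Zp (m a b n) by case: (mul_e a b).
have hZ a b c t' : Zp (\sum_n m a b n * m n c t').
  by apply: (padic_int_sum hp hC) => n _; exact: (padic_intM hp hC).
transitivity (\sum_n m j l n * m n i t).
  apply: (@lin_congr (fun t => \sum_n m i j n * m n l t) (fun t => \sum_n m j l n * m n i t)
    (e i * e j * e l)) => //; first exact: triple_product.
  by rewrite -mulrA mulrC; exact: triple_product.
by apply: eq_bigr => n _; rewrite (structure_comm i n).
Qed.

End Structure.

(* [rel z c] stands for evaluation z |-> c at a point of the chart, or of its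
   image in the other chart. *)
Variable rel : FC -> C -> Prop.
Hypothesis rel_ex : forall z, AC z -> exists c, rel z c.
Hypothesis rel_uniq : forall z c c', rel z c -> rel z c' -> c = c'.
Hypothesis relD : forall z w c c', rel z c -> rel w c' -> rel (z + w) (c + c').
Hypothesis relM : forall z w c c', rel z c -> rel w c' -> rel (z * w) (c * c').
Hypothesis rel_cst : forall c, rel (cst Q c) c.
Hypothesis rel_u : rel u 0.
Hypothesis u_unit : red_disc_unit ord AZ u.

Lemma rel1 : rel 1 1.
Proof. by have := rel_cst 1; rewrite rmorph1. Qed.

Lemma rel_sum (I : Type) (t : seq I) (P : pred I) (F : I -> FC) (c : I -> C) :
  (forall i, P i -> rel (F i) (c i)) ->
  rel (\sum_(i <- t | P i) F i) (\sum_(i <- t | P i) c i).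
Proof.
move=> h; apply: (big_rec2 rel); last by move=> i y z Pi; apply: relD; exact: h.
by have := rel_cst 0; rewrite rmorph0.
Qed.

Lemma relX z c n : rel z c -> rel (z ^+ n) (c ^+ n).
Proof. by move=> h; elim: n => [|n IH]; [exact: rel1 | rewrite !exprS; exact: relM]. Qed.

Lemma AZ_AC z : AZ z -> AC z. Proof. exact: chart_ring_sub. Qed.

(** Since u vanishes at the point, so does a power of z, and C has no nilpotents. *)
Lemma rel_rad z : Defs.rad AZ u z -> rel z 0.
Proof.
move=> [Az [n [w [Aw ez]]]].
have [c hc] := rel_ex (AZ_AC Az); have [c' hc'] := rel_ex (AZ_AC Aw).
have := relX n hc; rewrite ez => /rel_uniq /(_ (relM rel_u hc')); rewrite mul0r.
by move/eqP; rewrite expf_eq0 => /andP[_ /eqP <-].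
Qed.

(** 1 is a combination of the basis elements, so they do not all vanish at the point. *)
Lemma rel_basis_neq0 : exists j c, rel (chart_basis C infty j) c /\ c != 0.
Proof.
have [g e] := chart_one hT ratrCE infty.
apply: contrapT => h; have /eqP := oner_neq0 C; apply; apply: (rel_uniq rel1).
rewrite e.
have -> : 0 = \sum_(j : 'I_(dx Q)) 0 :> C by rewrite big1.
apply: rel_sum => j _.
have [c hc] := rel_ex (AZ_AC (chart_ring_basis infty Zp_semiring j)).
have c0 : c = 0 by apply/eqP/negPn/negP => c0; apply: h; exists j, c.
rewrite c0 in hc.
have [c' hc'] : exists c', rel (sub_at Q (chart_coord C infty) (map_poly f (g j))) c'.
  apply: rel_ex; rewrite -[sub_at _ _ _]mulr1; apply: (chart_ringZ setT_semiring) => //.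
  by apply: (chart_ring1 infty hT ratrCE).
by have := relM hc' hc; rewrite mulr0.
Qed.

(** The radical vanishes at the point, so the values t_i of the e_i multiply by the structure
    constants, and their Z_p-span contains the values of the chart ring. Integrality stands apart
    because it is needed alone for the roots of r, and also before residue classes can be
    discussed. *)
Lemma etale_chart_values :
  (forall z c, AZ z -> rel z c -> vge 0 c) /\
  ((forall z c, AZ z -> rel z c -> near_Zp ord c) -> forall z c, AZ z -> rel z c -> Qp c).
Proof.
have [q [e [m [eA gen inj mul unit]]]] := u_unit.
have /choice [t ht] : forall i, exists c, rel (e i) c by move=> i; exact/rel_ex/AZ_AC.
have rel_lin c : rel (\sum_i cst Q (c i) * e i) (\sum_i c i * t i).
  by apply: rel_sum => i _; exact: relM.
have t_mul i j : t i * t j = \sum_n m i j n * t n.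
  apply: (rel_uniq (relM (ht i) (ht j))).
  have [_ /rel_rad h] := mul i j.
  by have := relD h (rel_lin (m i j)); rewrite subrK add0r.
have m_Zp i j n : Zp (m i j n) by case: (mul i j).
have val z c : AZ z -> rel z c -> exists2 a, (forall i, Zp (a i)) & c = \sum_i a i * t i.
  move=> Az hz; have [a [ha /rel_rad h]] := gen z Az; exists a => //.
  by apply: (rel_uniq hz); have := relD h (rel_lin a); rewrite subrK add0r.
split=> [z c Az hz|near z c Az hz].
  have [a ha ->] := val z c Az hz; apply: (vge_sum hC) => i _; apply: (vgeMl hC).
    by case: (ha i).
  exact: (structure_point_integral hC m_Zp t_mul).
have t_neq0 : exists l, t l != 0.
  have [j [b [hb nb]]] := rel_basis_neq0.
  have [a _ eb] := val _ _ (chart_ring_basis infty Zp_semiring j) hb.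
  apply/existsP/contraT; rewrite negb_exists => /forallP t0; case/eqP: nb.
  by rewrite eb big1 // => i _; have := t0 i; rewrite negbK => /eqP ->; rewrite mulr0.
have [a ha ->] := val z c Az hz; apply: (padic_num_sum hp hC) => i _.
apply: (padic_numM hp hC); first by case: (ha i).
apply: (structure_point_padic hp hC m_Zp t_mul) => //.
  by move=> i' j l s; exact: (structure_assoc eA inj mul).
by move=> l; apply: near (ht l).
Qed.

End EtaleChart.

(** * Evaluation at points of the curve *)

Section Points.
Variables (R : realType) (p : nat) (C : closedFieldType) (ord : C -> \bar R).
Hypotheses (hp : prime p) (hC : padic_closure p ord).
Variables (T : triple) (r : {poly int}) (hT : curve_triple T r).
Hypothesis hgood : good_reduction p ord T r.

Local Notation Qp := (padic_num ord).
Local Notation Zp := (padic_int ord).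
Local Notation vge := (vge ord).
Local Notation v := (padic_val ord).
Local Notation Q := (plane_eqn T).
Local Notation FC := (funfield Q C).
Local Notation f := (ratrC hp hC).

Section Value.
Variable P : cpoint C T.
Local Notation infty := (at_infty P).
Local Notation s := (chart_coord C (at_infty P)).
Local Notation A S := (@chart_ring C T S (at_infty P)).

Lemma value_ex z : A setT z -> exists c, value P z c.
Proof. by move=> [g [_ ->]]; eexists; exists g. Qed.

Lemma value_uniq z c c' : value P z c -> value P z c' -> c = c'.
Proof.
move=> [g [-> ->]] [h [e ->]]; apply: eq_bigr => j _; congr (_.[_] * _).
have [_ _ gl _ _] := hgood; have [uW _] := gl infty.
apply/eqP; rewrite -subr_eq0; apply/eqP; move: j.
apply: (comb_basis_inj (plane_eqn_monic hT) (plane_eqn_size hT) (infty := infty) uW).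
by rewrite -(combD _ _ g (fun j => - h j)) -combN -/(chart_basis C infty) e subrr.
Qed.

Lemma valueD z w c c' : value P z c -> value P w c' -> value P (z + w) (c + c').
Proof.
move=> [g [-> ->]] [h [-> ->]]; exists (fun j => g j + h j); rewrite combD; split=> //.
by rewrite -big_split; apply: eq_bigr => j _; rewrite hornerD mulrDl.
Qed.

Lemma value_sub_at g z c : value P z c -> value P (sub_at Q s g * z) (g.[xval P] * c).
Proof.
move=> [h [-> ->]]; exists (fun j => g * h j); rewrite combZ; split=> //.
by rewrite mulr_sumr; apply: eq_bigr => j _; rewrite hornerM mulrA.
Qed.

Lemma value_basis j : value P (chart_basis C infty j) (bval P j).
Proof.
exists (fun i => (i == j)%:R); rewrite comb_delta; split=> //.
rewrite (bigD1 j) //= eqxx hornerE mul1r big1 ?addr0 // => i ij.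
by rewrite (negbTE ij) horner0 mul0r.
Qed.

Hypothesis hP : is_point ord P.

Lemma value1 : value P 1 1. Proof. by case: hP. Qed.

Lemma valueM z w c c' : value P z c -> value P w c' -> value P (z * w) (c * c').
Proof. by case: hP => _ h _; exact: h. Qed.

Lemma value_at g : value P (sub_at Q s g) g.[xval P].
Proof. by have := value_sub_at g value1; rewrite !mulr1. Qed.

Lemma value_cst c : value P (cst Q c) c.
Proof. by have := value_at c%:P; rewrite -cstE hornerC. Qed.

Lemma valueX z c n : value P z c -> value P (z ^+ n) (c ^+ n).
Proof.
by move=> h; elim: n => [|n IH]; [exact: value1 | rewrite !exprS; exact: valueM].
Qed.

Lemma etale_point_padic (u : FC) : value P u 0 -> red_disc_unit ord (A Zp) u ->
  near_Zp ord (xval P) -> (forall j, vge 0 (bval P j) -> near_Zp ord (bval P j)) ->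
  Qp (xval P) /\ forall j, Qp (bval P j).
Proof.
move=> u0 hu nx nb.
have [int padic] := etale_chart_values hp hC hT value_ex value_uniq valueD valueM value_cst u0 hu.
have bAZ j : A Zp (chart_basis C infty j) by exact: (chart_ring_basis infty (Zp_semiring hp hC)).
have {}padic : forall z c, A Zp z -> value P z c -> Qp c.
  apply: padic => z c [g [hg ->]] hz.
  have -> : c = \sum_j (g j).[xval P] * bval P j by apply: (value_uniq hz); exists g.
  apply: (near_Zp_sum hp hC) => j _; apply: (near_ZpM hp hC).
    rewrite horner_coef; apply: (near_Zp_sum hp hC) => i _; apply: (near_ZpM hp hC).
      apply: (near_ZpZp hC); exact: hg.
    exact: (near_ZpX hp hC).
  by apply: nb; exact: int (bAZ j) (value_basis j).
have bQp j : Qp (bval P j) by exact: padic (bAZ j) (value_basis j).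
split=> //.
(* x is not known to lie in the chart ring over Z_p, but x b_j does; its value is divided by that of
   b_j, for some b_j not vanishing at P. *)
have [j [c [hc nc]]] := rel_basis_neq0 hp hC hT value_ex value_uniq valueD valueM value_cst.
have := value_sub_at 'X hc; rewrite hornerX => /padic h.
rewrite -[xval P](mulfK nc); apply: (padic_numM hp hC).
  by apply: h; apply: (chart_ringZ (Zp_semiring hp hC)) => //; exact: (coefs_inX (Zp_semiring hp hC)).
apply: (padic_numV hp hC); rewrite (value_uniq hc (value_basis j)); exact: bQp.
Qed.

End Value.

Section OtherChart.
Variable P : cpoint C T.
Hypotheses (hP : is_point ord P) (Pinf : at_infty P = true) (xP : xval P != 0).
Local Notation u := (sub_at Q (chart_coord C true) 'X).
Local Notation x := (xval P).

Lemma value_u n : value P (u ^+ n) (x ^+ n).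
Proof.
by apply: (valueX hP); have := value_at hP 'X; rewrite hornerX Pinf.
Qed.

(* Evaluation at P of functions on the finite chart, x being nonzero at P. *)
Definition far_value (z : FC) (c : C) : Prop :=
  exists m, value P (u ^+ m * z) (x ^+ m * c).

Lemma far_value_raise z c m n : value P (u ^+ m * z) (x ^+ m * c) ->
  value P (u ^+ (m + n) * z) (x ^+ (m + n) * c).
Proof.
move=> h; rewrite addnC !exprD -!mulrA; apply: (valueM hP) => //; exact: value_u.
Qed.

Lemma far_value_uniq z c c' : far_value z c -> far_value z c' -> c = c'.
Proof.
move=> [m h] [m' h']; apply: (mulfI (expf_neq0 (m + m') xP)).
by apply: (value_uniq (far_value_raise m' h)); rewrite addnC; exact: far_value_raise.
Qed.

Lemma far_valueD z w c c' : far_value z c -> far_value w c' -> far_value (z + w) (c + c').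
Proof.
move=> [m h] [m' h']; exists (m + m')%N; rewrite !mulrDr; apply: valueD.
  exact: far_value_raise.
by rewrite addnC; exact: far_value_raise.
Qed.

Lemma far_valueM z w c c' : far_value z c -> far_value w c' -> far_value (z * w) (c * c').
Proof.
move=> [m h] [m' h']; exists (m + m')%N.
by rewrite !exprD ![_ * (z * w)]mulrACA ![_ * (c * c')]mulrACA; exact: (valueM hP).
Qed.

Lemma far_value_cst c : far_value (cst Q c) c.
Proof. by exists 0%N; rewrite !mul1r; exact: value_cst. Qed.

Lemma far_value_x : far_value (sub_at Q (chart_coord C false) 'X) x^-1.
Proof.
exists 1%N; rewrite !expr1 mulfV // !sub_atX -qpolyCM /= mulVf ?tofrac_eq0 ?polyX_eq0 //.
exact: (value1 hP).
Qed.

Lemma far_value_at g : far_value (sub_at Q (chart_coord C false) g) g.[x^-1].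
Proof.
rewrite sub_at_coef horner_coef.
apply: (rel_sum far_valueD far_value_cst) => j _; apply: far_valueM; first exact: far_value_cst.
exact: (relX far_valueM far_value_cst _ far_value_x).
Qed.

Lemma far_value_ex z : @chart_ring C T setT false z -> exists c, far_value z c.
Proof.
move=> [g [_ ->]].
have /choice [b hb] : forall j, exists c, far_value (chart_basis C false j) c.
  move=> j; have [m [g' e]] := chart_at_infinity hT (ratrCE hp hC) j.
  have [c hc] : exists c, value P (u ^+ m * chart_basis C false j) c.
    apply: value_ex; rewrite Pinf.
    by exists (fun l => map_poly f (g' l)); split; last exact: e.
  exists (c / x ^+ m), m.
  have -> : x ^+ m * (c / x ^+ m) = c by rewrite mulrC mulfVK // expf_neq0.
  exact: hc.
eexists; apply: (rel_sum far_valueD far_value_cst) => j _.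
by apply: far_valueM (hb j); exact: far_value_at.
Qed.

Lemma disc_root_integral : root (rover r C) x^-1 -> vge 0 x^-1.
Proof.
move=> /rootP r0; have [_ _ _ hu _] := hgood.
have u0 : far_value (sub_at Q (chart_coord C false) (rover r C)) 0.
  by rewrite -r0; exact: far_value_at.
have [int _] := etale_chart_values hp hC hT far_value_ex far_value_uniq far_valueD
  far_valueM far_value_cst u0 hu.
have [j [c [hc nc]]] := rel_basis_neq0 hp hC hT far_value_ex far_value_uniq far_valueD
  far_valueM far_value_cst.
have hn n : vge 0 (x^-1 ^+ n * c).
  apply: (int (sub_at Q (chart_coord C false) 'X^n * chart_basis C false j)).
    apply: (chart_ringZ (Zp_semiring hp hC)); last exact: (chart_ring_basis false (Zp_semiring hp hC)).
    move=> i; rewrite coefXn; exact: (padic_int_nat hp hC).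
  apply: far_valueM hc; rewrite -[X in far_value _ X]hornerXn; exact: far_value_at.
have nx : x^-1 != 0 by rewrite invr_neq0.
apply/(vgeE hC) => //; rewrite leNgt; apply/negP => neg.
(* With this n, the valuation of x^-n c would be at most -1. *)
have [n hn'] := nat_real ((v c + 1) / - v x^-1).
have /(vgeE hC _ (mulf_neq0 (expf_neq0 n nx) nc)) := hn n.
rewrite (vM hC) ?expf_neq0 // (vX hC) // => h.
have : v c + 1 <= n%:R * - v x^-1 by rewrite -ler_pdivrMr // oppr_gt0.
lra.
Qed.

End OtherChart.

Lemma very_bad_padic (e : nat) (he : (0 < e)%N) (varpi : C) (hvarpi : varpi ^+ e = p%:R)
  (P P' : cpoint C T) :
  point_over ord (padic_adjoin ord varpi) P -> is_point ord P' ->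
  same_disk ord P P' -> very_bad r P' ->
  Qp (xval P') /\ forall j, Qp (bval P' j).
Proof.
move=> [[_ _ ptP] KxP KbP] hP' [infPP' xPP' bPP'] bad.
have [_ _ _ u_fin u_inf] := hgood.
have vxP : vge 0 (xval P) by move: ptP; case: ifP => _ // /ltW.
have nx : near_Zp ord (xval P').
  apply: (near_Zp_shift hC (adjoin_near_Zp hp hC he hvarpi KxP vxP)).
  exact: (posC hC).
have nb j : vge 0 (bval P' j) -> near_Zp ord (bval P' j).
  (* Integrality passes from b_j(P') to b_j(P), which lies in Q_p(varpi) and so has its residue
     class in F_p; b_j(P') has the same one. *)
  move=> b0; apply: (near_Zp_shift hC (w := bval P j)); last exact: (posC hC).
  apply: (adjoin_near_Zp hp hC he hvarpi (KbP j)).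
  rewrite -[bval P j](subrK (bval P' j)); apply: (vgeD hC) => //; exact/pos_vge0/bPP'.
have [inf|fin] := boolP (at_infty P').
  (* At infinity the unit discriminant concerns the locus 1/x = 0 only. Otherwise x(P') would be a
     root of r; it is non-integral in this chart, against [disc_root_integral]. *)
  have x0 : xval P' = 0.
    case: bad => [[] //|]; rewrite inf => rt.
    apply/eqP/negPn/negP => nx0.
    have := disc_root_integral hP' inf nx0 rt.
    have [_ _] := hP'; rewrite inf => /(pos_vge hC)[d d0 hd] /(vgeE hC _ (invr_neq0 nx0)).
    rewrite (vV hC) // oppr_ge0 => h; move: hd => /(vgeE hC _ nx0) hd.
    by have := lt_le_trans d0 (le_trans hd h); rewrite ltxx.
  have e1 : value P' (sub_at Q (chart_coord C (at_infty P')) 'X) 0.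
    by have := value_at hP' 'X; rewrite hornerX x0.
  apply: (etale_point_padic hP' e1 _ nx nb).
  rewrite inf; exact: u_inf.
have [|rt] := bad; first by case=> inf; rewrite inf in fin.
rewrite (negbTE fin) in rt.
have e1 : value P' (sub_at Q (chart_coord C (at_infty P')) (rover r C)) 0.
  by have := value_at hP' (rover r C); rewrite (rootP rt).
apply: (etale_point_padic hP' e1 _ nx nb).
rewrite (negbTE fin); exact: u_fin.
Qed.

End Points.

(** * Precision of the tiny integral *)

Theorem proposition4p1
  (R : realType) (p : nat) (C : closedFieldType) (ord : C -> \bar R)
  (hp : prime p) (hC : padic_closure p ord)
  (T : triple) (r : {poly int}) (hT : curve_triple T r)
  (hgood : good_reduction p ord T r)
  (e N : nat) (he : (0 < e)%N) (hN : (0 < N)%N)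
  (varpi : C) (hvarpi : varpi ^+ e = p%:R)
  (P Q P' : cpoint C T)
  (hP : point_over ord (padic_adjoin ord varpi) P)
  (hQ : point_over ord (padic_adjoin ord varpi) Q)
  (hPQ : same_disk ord P Q)
  (hP' : [/\ bad_disk ord r P, is_point ord P', same_disk ord P P' & very_bad r P']
         \/ (~ bad_disk ord r P /\ P' = P))
  (c : option 'I_(dx (plane_eqn T))) (hc : local_coord ord P' c)
  (h : funfield (plane_eqn T) C) (hh : second_kind ord h)
  (k : nat) (hk : (0 < k)%N) (a : int -> C)
  (ha : forall i : int, - k%:Z <= i -> padic_int ord (a i))
  (hga : diff_expansion h P' (tfun P' c) k a)
  (Pt Qt Pt' : cpoint C T)
  (hPt : accurate_point ord N Pt P) (hQt : accurate_point ord N Qt Q)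
  (hPt' : accurate_point ord N Pt' P')
  (l : nat) (at_ : int -> C)
  (hat : forall i : int, - k%:Z <= i < l%:Z -> accurate ord N (at_ i) (a i))
  (hinv : (1 < k)%N ->
     (ord (tcoord Pt' c Pt) < N%:R%:E)%E /\ (ord (tcoord Pt' c Qt) < N%:R%:E)%E) :
  exists2 I : C, tiny_integral ord a k (tcoord P' c P) (tcoord P' c Q) I &
    (mine (mine (nu1 R p e l) (nu2 R p e N l))
          (nu3 p ord N k (tcoord P' c P) (tcoord P' c Q))
     <= ord (partial_integral at_ k (tcoord Pt' c Pt) (tcoord Pt' c Qt) (k + l)%N - I)%R)%E.
Proof.
have [[ptP KxP KbP] [_ KxQ KbQ]] := (hP, hQ).
have [Kx' Kb' [_ xPP' bPP']] : [/\ padic_adjoin ord varpi (xval P'),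
    forall j, padic_adjoin ord varpi (bval P' j) & same_disk ord P P'].
  case: hP' => [[_ ptP' PP' bad]|[_ ->]].
    have [x' b'] := very_bad_padic hp hC hT hgood he hvarpi hP ptP' PP' bad.
    by split=> [|j|//]; apply: (adjoin_Qp hp hC).
  by split=> //; split=> // [|j]; rewrite subrr; exact: pos0 hC.
have [_ xPQ bPQ] := hPQ.
have Kt P1 : padic_adjoin ord varpi (xval P1) ->
    (forall j, padic_adjoin ord varpi (bval P1 j)) -> padic_adjoin ord varpi (tcoord P' c P1).
  by case: (c) => [j|] hx hb; apply: (adjoinB hp hC).
(* The centre P' is itself known only to precision N; a difference of two such coordinates keeps
   that precision. *)
have near_t P1 P1t : accurate_point ord N P1t P1 ->
    vge ord N%:R (tcoord Pt' c P1t - tcoord P' c P1).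
  move: hPt' => [_ hx' hb'] [_ hx hb].
  have sub (y y' w w' : C) : vge ord N%:R (y' - y) -> vge ord N%:R (w' - w) ->
      vge ord N%:R (y' - w' - (y - w)).
    by move=> hy hw; rewrite opprD addrACA -opprD; exact: (vgeB hC).
  by case: (c) => [j|]; apply: sub; [exact: hb|exact: hb'| exact: hx|exact: hx'].
have pP : (0 < ord (tcoord P' c P))%E by case: (c) => [j|]; [exact: bPP'|exact: xPP'].
have pQ : (0 < ord (tcoord P' c Q))%E.
  (* Both disk relations are stated from P, so t(Q) is reached from t(P). *)
  have -> : tcoord P' c Q = (tcoord P' c P) - (tcoord Q c P).
    by case: (c) => [j|] /=; ring.
  apply: (posD hC pP); apply: (posN hC).
  by case: (c) => [j|]; [exact: bPQ | exact: xPQ].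
exact: (tiny_integral_precision hp hC he hvarpi ha (Kt _ KxP KbP) (Kt _ KxQ KbQ) pP pQ hN
  (near_t _ _ hPt) (near_t _ _ hQt) hat hinv).
Qed.
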